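(* Let $\nu$ be the measure on $S$ given by $d\nu(s)=|s|^{-4}\,ds$, where $|s|^2=\operatorname{tr}(s^*s)=s_{11}^2+s_{22}^2+|s_{21}|^2$. Then the representation $\pi$ of the group $P$ by the operators $T(g)$, $g\in P$, in the Hilbert space $L^2(S,\nu)$ is special, and it has a nontrivial $1$-cocycle of the form $$b(g)=T(g)f-f,\quad g\in P,\qquad\text{where } f(s)=e^{-|s|/2}.$$
   Context: Notation: $*$ is the conjugate transpose and $e_2$ is the $2\times2$ identity matrix. $S$ is the group of lower triangular complex $2\times 2$ matrices $s=\begin{pmatrix} s_{11}&0\\ s_{21}&s_{22}\end{pmatrix}$ with $s_{11},s_{22}>0$ and $s_{21}\in\mathbb C$. $N$ is the additive group of skew-Hermitian complex $2\times2$ matrices ($n+n^*=0$). $P$ is the group of block matrices generated by the matrices $\begin{pmatrix} e_2&0\\ n&e_2\end{pmatrix}$, $n\in N$, and $\begin{pmatrix} s^{*-1}&0\\0&s\end{pmatrix}$, $s\in S$; these two families of matrices are identified with $N$ and $S$. $P$ is the semidirect product of $S$ and the normal subgroup $N$, with $S$ acting on $N$ by $n\mapsto sns^*$, so each element of $P$ is uniquely of the form $g=ns_0$ with $n\in N$, $s_0\in S$. $ds=ds_{11}\,ds_{22}\,ds_{21}\,d\bar s_{21}$ is Lebesgue measure on $S$ (up to a constant factor, Lebesgue measure in the real coordinates $s_{11},s_{22},\operatorname{Re}s_{21},\operatorname{Im}s_{21}$). Let $\hat N$ be the group of continuous unitary characters of $N$, on which $S$ acts by $\chi\mapsto\chi_s$,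 $\chi_s(n)=\chi(sns^* )$. This action has four orbits of positive measure (the nondegenerate orbits). Fix a character $\chi$ in one of these four orbits. The representation $T$ of $P$ in $L^2(S,\nu)$ is defined by $(T(n)F)(s)=\chi(sns^* )F(s)$ for $n\in N$, $(T(s_0)F)(s)=F(ss_0)$ for $s_0\in S$, and $T(ns_0)=T(n)T(s_0)$. These operators are bounded but not necessarily unitary. The same formulas define $T(g)f$ for any measurable function $f$ on $S$. A $1$-cocycle of a representation $T$ of $P$ in a Hilbert space $H$ is a continuous map $b:P\to H$ with $b(g_1g_2)=T(g_1)b(g_2)+b(g_1)$ for all $g_1,g_2\in P$. It is nontrivial if there is no $\xi\in H$ with $b(g)=T(g)\xi-\xi$ for all $g\in P$. The representation is called special if it has a nontrivial $1$-cocycle. *)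

(* Defs.v *)
From HB Require Import structures.
From mathcomp Require Import all_boot all_order all_algebra.
From mathcomp Require Import sesquilinear spectral.
From mathcomp Require Import complex.
From mathcomp Require Import all_classical all_reals all_analysis.
From mathcomp Require Import measurable_realfun.

Set Implicit Arguments.
Unset Strict Implicit.
Unset Printing Implicit Defensive.

Import Order.TTheory GRing.Theory Num.Theory.
Import numFieldTopology.Exports.
Import ComplexField.Normc.

Local Open Scope classical_set_scope.
Local Open Scope ring_scope.
Local Open Scope complex_scope.
Local Open Scope sesquilinear_scope.

HB.instance Definition _ (R : realType) := PseudoPointedMetric.copy R[i] (R[i])^o.

(* Elements of the complex space L^2(mu) are represented by functions in
   [L2 mu], equality in L^2(mu) being equality mu-almost everywhere. *)
Section complex_L2.
Context d (X : measurableType d) (R : realType).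
Variable mu : {measure set X -> \bar R}.
Implicit Types F : X -> R[i].

Definition measurable_complex F :=
  measurable_fun setT (fun x => complex.Re (F x)) /\
  measurable_fun setT (fun x => complex.Im (F x)).

Definition L2norm F : \bar R := Lnorm mu 2%:E (fun x => (normc (F x))%:E).

Definition L2 : set (X -> R[i]) :=
  [set F | measurable_complex F /\ (L2norm F < +oo)%E].

(* A group of n x n matrices G, with the topology induced from 'M[R[i]]_n,
   acts on functions by T. *)
Variables (n : nat) (G : set 'M[R[i]]_n).
Variable T : 'M[R[i]]_n -> (X -> R[i]) -> (X -> R[i]).

Definition L2_representation :=
  [/\ forall g, G g -> forall F, L2 F -> L2 (T g F),
      forall g, G g -> forall (a : R[i]) F1 F2, L2 F1 -> L2 F2 ->
        T g (fun x => a * F1 x + F2 x)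
          = (fun x => a * T g F1 x + T g F2 x) %[ae mu],
      forall g, G g -> exists K : R, forall F, L2 F ->
        (L2norm (T g F) <= K%:E * L2norm F)%E,
      forall F, L2 F -> T 1%:M F = F %[ae mu]
    & forall g1 g2, G g1 -> G g2 -> forall F, L2 F ->
        T (g1 *m g2) F = T g1 (T g2 F) %[ae mu]].

Definition cocycle (b : 'M[R[i]]_n -> X -> R[i]) :=
  [/\ forall g, G g -> L2 (b g),
      forall g0, G g0 ->
        L2norm (fun x => b g x - b g0 x) @[g --> within G (nbhs g0)] --> 0%E
    & forall g1 g2, G g1 -> G g2 ->
        b (g1 *m g2) = (fun x => T g1 (b g2) x + b g1 x) %[ae mu]].

Definition coboundary (b : 'M[R[i]]_n -> X -> R[i]) :=
  exists2 xi, L2 xi &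
    forall g, G g -> b g = (fun x => T g xi x - xi x) %[ae mu].

Definition nontrivial_cocycle b := cocycle b /\ ~ coboundary b.

Definition special := exists b, nontrivial_cocycle b.

End complex_L2.

Lemma product_sigma_finite d1 d2 (T1 : measurableType d1)
    (T2 : measurableType d2) (R : realType)
    (m1 : {sigma_finite_measure set T1 -> \bar R})
    (m2 : {sigma_finite_measure set T2 -> \bar R}) :
  sigma_finite setT (m1 \x m2)%E.
Proof.
have /sigma_finiteP[F [TF ndF Foo]] := sigma_finiteT m1.
have /sigma_finiteP[G [TG ndG Goo]] := sigma_finiteT m2.
exists (fun n => F n `*` G n).
  rewrite -setXTT TF TG predeqE => -[x y]; split.
    move=> [/= [n _ Fnx] [k _ Gky]]; exists (maxn n k) => //; split.
    - by move: x Fnx; exact/subsetPset/ndF/leq_maxl.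
    - by move: y Gky; exact/subsetPset/ndG/leq_maxr.
  by move=> [n _ []/= ? ?]; split; exists n.
move=> k; have [? ?] := Foo k; have [? ?] := Goo k.
split; first exact: measurableX.
by rewrite product_measure1E// lte_mul_pinfty// ge0_fin_numE.
Qed.

Section lebesgue4.
Variable R : realType.
Local Notation mR := (measurableTypeR R).

Definition lebesgue2 : set (mR * mR)%type -> \bar R :=
  (@lebesgue_measure R \x @lebesgue_measure R)%E.

HB.instance Definition _ := Measure.on lebesgue2.
HB.instance Definition _ := Measure_isSigmaFinite.Build _ _ _ lebesgue2
  (product_sigma_finite (@lebesgue_measure R) (@lebesgue_measure R)).

Definition R4 := ((mR * mR) * (mR * mR))%type.
HB.instance Definition _ := Measurable.on R4.

Definition lebesgue4 : set R4 -> \bar R := (lebesgue2 \x lebesgue2)%E.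

HB.instance Definition _ := Measure.on lebesgue4.
HB.instance Definition _ := Measure_isSigmaFinite.Build _ _ _ lebesgue4
  (product_sigma_finite lebesgue2 lebesgue2).

End lebesgue4.
Arguments lebesgue2 {R}.
Arguments lebesgue4 {R}.

Section groups.
Variable R : realType.
Local Notation C := R[i].

Definition skewN : set 'M[C]_2 := [set n | n + n ^t* = 0].

(* In R[i], 0 < z means that z is real and positive. *)
Definition lower_pos (s : 'M[C]_2) : bool :=
  [&& s 0 1 == 0, 0 < s 0 0 & 0 < s 1 1].

Record lowS := MkS { smx :> 'M[C]_2; smxP : lower_pos smx }.

HB.instance Definition _ := [isSub for smx].
HB.instance Definition _ := [Choice of lowS by <:].

Lemma lower_pos1 : lower_pos 1%:M.
Proof. by rewrite /lower_pos !mxE /= eqxx ltr01. Qed.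

Definition oneS : lowS := MkS lower_pos1.

HB.instance Definition _ := isPointed.Build lowS oneS.

Lemma lower_pos_mul (s t : lowS) : lower_pos (s *m t).
Proof.
case: s t => [s /and3P[/eqP s01 s0 s1]] [t /and3P[/eqP t01 t0 t1]] /=.
apply/and3P; split; rewrite !mxE !big_ord_recl big_ord0 /= !addr0.
- have -> : lift ord0 ord0 = 1 :> 'I_2 by apply: val_inj.
  by rewrite t01 s01 mulr0 mul0r addr0.
- have -> : lift ord0 ord0 = 1 :> 'I_2 by apply: val_inj.
  by rewrite s01 mul0r addr0 mulr_gt0.
- have -> : lift ord0 ord0 = 1 :> 'I_2 by apply: val_inj.
  by rewrite t01 mulr0 add0r mulr_gt0.
Qed.

Definition mulS (s t : lowS) : lowS := MkS (lower_pos_mul s t).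

Definition N_block (n : 'M[C]_2) : 'M[C]_(2 + 2) := block_mx 1%:M 0 n 1%:M.
Definition S_block (s : 'M[C]_2) : 'M[C]_(2 + 2) :=
  block_mx (invmx (s ^t*)) 0 0 s.

Inductive grpP : set 'M[C]_(2 + 2) :=
| P_N n : skewN n -> grpP (N_block n)
| P_S (s : lowS) : grpP (S_block s)
| P_1 : grpP 1%:M
| P_mul g h : grpP g -> grpP h -> grpP (g *m h)
| P_inv g : grpP g -> grpP (invmx g).

(* The factors n and s of g = n s; P_decomposition and P_partE below show that
   these formulas compute them. *)
Definition S_part (g : 'M[C]_(2 + 2)) : lowS := insubd oneS (drsubmx g).
Definition N_part (g : 'M[C]_(2 + 2)) : 'M[C]_2 :=
  dlsubmx g *m invmx (ulsubmx g).

Lemma S_unitmx (s : lowS) : (s : 'M[C]_2) \in unitmx.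
Proof.
have trig : is_trig_mx (s : 'M[C]_2).
  apply/is_trig_mxP => -[[|[|[]]] // i] [[|[|[]]] // j] //= _.
  case: s => s /= /and3P[/eqP s01 _ _].
  by rewrite -[RHS]s01; congr (s _ _); apply: val_inj.
rewrite unitmxE (det_trig trig) !big_ord_recl big_ord0 mulr1 unitfE.
case: s {trig} => s /= /and3P[_ s0 s1].
have -> : lift ord0 ord0 = 1 :> 'I_2 by apply: val_inj.
by rewrite mulf_neq0 ?gt_eqF.
Qed.

Lemma unitmx_tC m (A : 'M[C]_m) : (A ^t* \in unitmx) = (A \in unitmx).
Proof. by rewrite map_unitmx unitmx_tr. Qed.

Lemma NS_blockE (n : 'M[C]_2) (s : lowS) : N_block n *m S_block s =
  block_mx (invmx (s ^t*)) 0 (n *m invmx (s ^t*)) s.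
Proof.
by rewrite /N_block /S_block mulmx_block !mul1mx !mul0mx !mulmx0 !addr0 !add0r.
Qed.

Lemma P_partE (n : 'M[C]_2) (s : lowS) :
  N_part (N_block n *m S_block s) = n /\ S_part (N_block n *m S_block s) = s.
Proof.
rewrite NS_blockE /N_part /S_part block_mxKdl block_mxKul block_mxKdr; split.
  by rewrite mulmxK // unitmx_inv unitmx_tC S_unitmx.
by apply: val_inj; rewrite val_insubd smxP.
Qed.

Lemma invmx_eq m (A B : 'M[C]_m) : A *m B = 1%:M -> invmx A = B.
Proof.
by move=> AB; have [Au _] := mulmx1_unit AB; rewrite -(mulKmx Au B) AB mulmx1.
Qed.

Lemma lower_pos_inv (s : lowS) : lower_pos (invmx s).
Proof.
have e1 : lift ord0 ord0 = 1 :> 'I_2 by apply: val_inj.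
have := mulmxV (S_unitmx s); case: s => s /= /and3P[/eqP s01 s0 s1].
move: (invmx s) => t /matrixP st.
have := st 0 0; have := st 0 1; have := st 1 1.
rewrite !mxE !big_ord_recl !big_ord0 /= !addr0 !e1 s01 !mul0r !addr0.
move=> t11 /eqP; rewrite mulf_eq0 gt_eqF //= => /eqP t01 t00.
rewrite t01 mulr0 add0r in t11.
apply/and3P; split; first exact/eqP.
  by rewrite -(pmulr_rgt0 _ s0) t00 ltr01.
by rewrite -(pmulr_rgt0 _ s1) t11 ltr01.
Qed.

Definition invS (s : lowS) : lowS := MkS (lower_pos_inv s).

Lemma N_conj (s : lowS) n : skewN n -> skewN (s *m n *m s ^t*).
Proof.
rewrite /skewN /= => nN.
have -> : (s *m n *m s ^t*) ^t* = s *m n ^t* *m s ^t*.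
  by rewrite !trmx_mul !map_mxM /= trmxCK mulmxA.
by rewrite -mulmxDl -mulmxDr nN mulmx0 mul0mx.
Qed.

Lemma N_blockD n n' : N_block n *m N_block n' = N_block (n + n').
Proof.
by rewrite /N_block mulmx_block !mul1mx !mul0mx !mulmx1 mulmx0 !addr0 add0r.
Qed.

Lemma S_blockM (s t : lowS) : S_block s *m S_block t = S_block (mulS s t).
Proof.
rewrite /S_block mulmx_block !mul0mx !mulmx0 !addr0 !add0r /=; congr block_mx.
apply/esym/invmx_eq; rewrite trmx_mul map_mxM /=.
rewrite mulmxA mulmxK ?unitmx_tC ?S_unitmx //.
by rewrite mulmxV // unitmx_tC S_unitmx.
Qed.

Lemma S_blockN (s : lowS) n :
  S_block s *m N_block n = N_block (s *m n *m s ^t*) *m S_block s.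
Proof.
rewrite NS_blockE /S_block /N_block mulmx_block.
rewrite !mul0mx !mulmx0 !mulmx1 !addr0 !add0r; congr block_mx.
by rewrite mulmxK // unitmx_tC S_unitmx.
Qed.

Lemma S_block1 : S_block oneS = 1%:M.
Proof. by rewrite /S_block /= trmx1 map_mx1 invmx1 -scalar_mx_block. Qed.

Lemma N_block0 : N_block 0 = 1%:M.
Proof. by rewrite /N_block -scalar_mx_block. Qed.

Lemma P_decomposition g :
  grpP g <-> exists n, exists s : lowS, skewN n /\ g = N_block n *m S_block s.
Proof.
have N0 : skewN 0 by rewrite /skewN /= trmx0 map_mx0 addr0.
split; last first.
  by move=> [n [s [nN ->]]]; apply: P_mul; [exact: P_N|exact: P_S].
elim=> {g} [n nN|s||g h _ [n [s [nN ->]]] _ [n' [s' [n'N ->]]]|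
            g _ [n [s [nN ->]]]].
- by exists n, oneS; split=> //; rewrite S_block1 mulmx1.
- by exists 0, s; split=> //; rewrite N_block0 mul1mx.
- by exists 0, oneS; split=> //; rewrite S_block1 mulmx1 N_block0.
- exists (n + s *m n' *m s ^t*), (mulS s s'); split.
    have := N_conj s n'N; rewrite /skewN /= => h1.
    by rewrite linearD /= map_mxD addrACA nN h1 addr0.
  rewrite -N_blockD -S_blockM !mulmxA; congr (_ *m _).
  by rewrite -[LHS]mulmxA S_blockN mulmxA.
- exists (- (invS s *m n *m (invS s) ^t*)), (invS s); split.
    have := N_conj (invS s) nN; rewrite /skewN /= => h1.
    by rewrite linearN /= map_mxN -opprD h1 oppr0.
  apply: invmx_eq.
  have -> : - (invS s *m n *m invS s ^t*) = invS s *m (- n) *m invS s ^t*.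
    by rewrite mulmxN mulNmx.
  rewrite -S_blockN -mulmxA [S_block s *m _]mulmxA S_blockM.
  have -> : mulS s (invS s) = oneS.
    by apply: val_inj; rewrite /= mulmxV // S_unitmx.
  by rewrite S_block1 mul1mx N_blockD subrr N_block0.
Qed.

Definition S_coord (s : lowS) : R4 R :=
  ((complex.Re (s 0 0), complex.Re (s 1 1)),
   (complex.Re (s 1 0), complex.Im (s 1 0))).

Definition mx_of_coord (x : R4 R) : 'M[C]_2 :=
  \matrix_(i, j) if i == 0 then (if j == 0 then x.1.1%:C else 0)
                 else (if j == 0 then x.2.1 +i* x.2.2 else x.1.2%:C).

Definition S_of_coord (x : R4 R) : lowS := insubd oneS (mx_of_coord x).

Definition S_domain : set (R4 R) :=
  [set x | 0 < x.1.1 /\ 0 < x.1.2].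

Lemma lower_pos_coord x :
  lower_pos (mx_of_coord x) = (0 < x.1.1) && (0 < x.1.2).
Proof. by rewrite /lower_pos !mxE /= eqxx !ltcR. Qed.

Lemma S_of_coordK x : S_domain x -> S_coord (S_of_coord x) = x.
Proof.
move=> [x1 x2]; rewrite /S_coord /S_of_coord val_insubd lower_pos_coord x1 x2.
by rewrite !mxE /=; case: x {x1 x2} => [[? ?] [? ?]].
Qed.

Lemma S_coordK s : S_of_coord (S_coord s) = s.
Proof.
have sE : mx_of_coord (S_coord s) = s.
  have /and3P[/eqP s01 s0 s1] := smxP s; apply/matrixP.
  have e0 (z : C) : 0 < z -> (complex.Re z)%:C = z.
    by case: z => a b; rewrite ltcE /= => /andP[/eqP -> _].
  move=> [[|[|[]]] // i] [[|[|[]]] // j]; rewrite !mxE /=.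
  - by rewrite e0 //; congr (s _ _); apply: val_inj.
  - by rewrite -[LHS]s01; congr (s _ _); apply: val_inj.
  - rewrite (_ : s _ _ = s 1 0); first by case: (s 1 0).
    by congr (s _ _); apply: val_inj.
  - by rewrite e0 //; congr (s _ _); apply: val_inj.
by apply: val_inj; rewrite /S_of_coord val_insubd sE smxP.
Qed.

HB.instance Definition _ :=
  Measurable.copy lowS (g_sigma_algebra_preimageType S_coord).

Lemma measurable_S_domain : measurable S_domain.
Proof.
have -> : S_domain = (`]0, +oo[ `*` `]0, +oo[) `*` setT :> set (R4 R).
  apply/seteqP; split=> -[[a b] c] /=; rewrite !in_itv /= !andbT.
    by move=> [? ?].
  by move=> [[? ?] _].
by do 2?apply: measurableX.
Qed.

Lemma measurable_S_coord : measurable_fun setT S_coord.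
Proof. by move=> _ B mB; exists B. Qed.

Lemma S_of_coord_out x : ~ S_domain x -> S_of_coord x = oneS.
Proof.
move=> nDx; apply: val_inj; rewrite /S_of_coord val_insubd lower_pos_coord.
by case: ifPn => // /andP[? ?]; case: nDx.
Qed.

Lemma measurable_S_of_coord : measurable_fun setT S_of_coord.
Proof.
move=> _ _ [B mB <-]; rewrite !setTI.
pose E : set (R4 R) := [set _ | B (S_coord oneS)].
have mE : measurable E.
  have [q|q] := pselect (B (S_coord oneS)).
    by rewrite (_ : E = setT); [exact: measurableT|apply/seteqP; split=> x].
  by rewrite (_ : E = set0); [exact: measurable0|apply/seteqP; split=> x].
rewrite (_ : _ @^-1` _ = (S_domain `&` B) `|` (~` S_domain `&` E)).
  have mD := measurable_S_domain.
  by apply: measurableU; apply: measurableI => //; exact: measurableC.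
apply/seteqP; split=> x /=.
  have [Dx|nDx] := pselect (S_domain x); first by rewrite S_of_coordK //; left.
  by rewrite S_of_coord_out //; right.
by move=> [[Dx Bx]|[nDx Ex]]; [rewrite S_of_coordK|rewrite S_of_coord_out].
Qed.

HB.instance Definition _ :=
  isMeasurableFun.Build _ _ _ _ S_of_coord measurable_S_of_coord.

(* Lebesgue measure in the real coordinates S_coord. *)
Definition ds : set lowS -> \bar R :=
  pushforward (mrestr lebesgue4 measurable_S_domain) S_of_coord.

Let ds0 : ds set0 = 0%E. Proof. exact: measure0. Qed.
Let ds_ge0 A : (0 <= ds A)%E. Proof. exact: measure_ge0. Qed.
Let ds_sigma_additive : semi_sigma_additive ds.
Proof. exact: measure_semi_sigma_additive. Qed.

HB.instance Definition _ := isMeasure.Build _ _ _ ds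
  ds0 ds_ge0 ds_sigma_additive.

Definition S_norm (s : lowS) : R := Num.sqrt (complex.Re (\tr (s ^t* *m s))).

Definition nuS (A : set lowS) : \bar R :=
  (\int[ds]_(s in A) ((S_norm s) ^- 4)%:E)%E.

Lemma S_norm_sqE (s : lowS) : complex.Re (\tr (s ^t* *m s)) =
  (S_coord s).1.1 ^+ 2 + (S_coord s).1.2 ^+ 2 +
  ((S_coord s).2.1 ^+ 2 + (S_coord s).2.2 ^+ 2).
Proof.
have e1 : lift ord0 ord0 = 1 :> 'I_2 by apply: val_inj.
rewrite /mxtrace !big_ord_recl !big_ord0 !mxE !big_ord_recl !big_ord0 !mxE /=.
rewrite !e1 /S_coord /=.
have /and3P[/eqP -> s0 s1] := smxP s.
move: s0 s1; case: (s 0 0) => a b; case: (s 1 1) => c d; case: (s 1 0) => p q.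
rewrite !ltcE /= => /andP[/eqP -> _] /andP[/eqP -> _].
rewrite !mulr0 !mulNr !opprK !addr0 oppr0 !add0r.
by rewrite !addr0 -!expr2 addrAC.
Qed.

Lemma measurable_S_norm : measurable_fun setT S_norm.
Proof.
have m1 := measurable_S_coord.
rewrite /S_norm; under eq_fun do rewrite S_norm_sqE.
apply: (measurableT_comp (f := @Num.sqrt R)).
  exact: (continuous_measurable_fun (@sqrt_continuous R)).
have m11 : measurable_fun setT (fun s => (S_coord s).1.1 : R).
  exact: (measurableT_comp measurable_fst (measurableT_comp measurable_fst m1)).
have m12 : measurable_fun setT (fun s => (S_coord s).1.2 : R).
  exact: (measurableT_comp measurable_snd (measurableT_comp measurable_fst m1)).
have m21 : measurable_fun setT (fun s => (S_coord s).2.1 : R).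
  exact: (measurableT_comp measurable_fst (measurableT_comp measurable_snd m1)).
have m22 : measurable_fun setT (fun s => (S_coord s).2.2 : R).
  exact: (measurableT_comp measurable_snd (measurableT_comp measurable_snd m1)).
by do !apply: measurable_funD; apply: measurable_funX.
Qed.

Lemma measurable_nu_density :
  measurable_fun setT (fun s => ((S_norm s) ^- 4)%:E).
Proof.
apply/measurable_EFinP; under eq_fun do rewrite -powR_invn ?sqrtr_ge0 //.
exact: (measurableT_comp (measurable_powR _) measurable_S_norm).
Qed.

Let nu0 : nuS set0 = 0%E. Proof. exact: integral_set0. Qed.
Let nu_ge0 A : (0 <= nuS A)%E.
Proof.
by apply: integral_ge0 => s _; rewrite lee_fin invr_ge0 exprn_ge0 ?sqrtr_ge0.
Qed.
Let nu_sigma_additive : semi_sigma_additive nuS.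
Proof.
apply: semi_sigma_additive_nng_induced => [|s].
  exact: measurable_nu_density.
by rewrite lee_fin invr_ge0 exprn_ge0 ?sqrtr_ge0.
Qed.

HB.instance Definition _ := isMeasure.Build _ _ _ nuS
  nu0 nu_ge0 nu_sigma_additive.

Definition unitary_character (chi : 'M[C]_2 -> C) :=
  [/\ forall n, skewN n -> `|chi n| = 1,
      forall n n', skewN n -> skewN n' -> chi (n + n') = chi n * chi n'
    & {within skewN, continuous chi}].

Definition eq_character (chi psi : 'M[C]_2 -> C) :=
  forall n, skewN n -> chi n = psi n.

Definition char_act (s : lowS) (chi : 'M[C]_2 -> C) : 'M[C]_2 -> C :=
  fun n => chi (s *m n *m s ^t*).

Definition char_orbit (chi : 'M[C]_2 -> C) : set ('M[C]_2 -> C) :=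
  [set psi | exists s : lowS, eq_character psi (char_act s chi)].

(* The dual group of skewN is identified with R^4, carrying Lebesgue measure, by
   the isomorphism sending y to the character
   n |-> exp (i (y_1 Im n_11 + y_2 Im n_22 + y_3 Re n_21 + y_4 Im n_21)). *)
Definition dual_char (y : R4 R) (n : 'M[C]_2) : C :=
  let t := y.1.1 * complex.Im (n 0 0) + y.1.2 * complex.Im (n 1 1) +
           (y.2.1 * complex.Re (n 1 0) + y.2.2 * complex.Im (n 1 0)) in
  cos t +i* sin t.

Definition dual_measure (A : set ('M[C]_2 -> C)) : \bar R :=
  lebesgue4 [set y | A (dual_char y)].

Definition in_nondegenerate_orbit (chi : 'M[C]_2 -> C) :=
  (0 < dual_measure (char_orbit chi))%E.

Definition opT (chi : 'M[C]_2 -> C) (g : 'M[C]_(2 + 2)) (F : lowS -> C) :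
    lowS -> C :=
  fun s => chi (s *m N_part g *m s ^t*) * F (mulS s (S_part g)).

Definition f_exp (s : lowS) : C := (expR (- S_norm s / 2))%:C.

End groups.

(* Main.v *)
Require Import Defs.
From mathcomp Require Import all_boot all_order all_algebra.
From mathcomp Require Import sesquilinear.
From mathcomp Require Import complex.
From mathcomp Require Import all_classical all_reals all_analysis.
From mathcomp Require Import measurable_realfun ring lra.

(* The measure nu is invariant under dilations s |-> l s and quasi-invariant,
   with bounded density, under right translations, so T acts boundedly. Near
   s = 0 the function f tends to 1, so f is not in L^2(nu), but T(g) f - f is:
   f is Lipschitz, |chi(s n s^* ) - 1|^2 = O(|s|^2), and |s|^2 e^(-c|s|) is
   nu-integrable because |s|^(-2) e^(-c|s|) is Lebesgue integrable in dimension
   4. The same estimate for T(g) f - T(g0) f gives the continuity of the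
   cocycle. If xi in L^2(nu) had the same coboundary as f, dilation invariance
   would bound the norm of s |-> f(s) - f(l s) by 2 |xi| for every l, and l
   tending to infinity would put f in L^2(nu). But then f and f(2 .) would have
   the same finite norm although f > f(2 .) everywhere. *)

Set Implicit Arguments.
Unset Strict Implicit.
Unset Printing Implicit Defensive.

Import Order.TTheory GRing.Theory Num.Theory.
Import numFieldNormedType.Exports.
Import ComplexField.Normc.

Local Open Scope classical_set_scope.
Local Open Scope ring_scope.
Local Open Scope complex_scope.
Local Open Scope sesquilinear_scope.

(** * Integration against densities and affine maps *)

(** Integrability of |x|^(-2) e^(-c|x|) on R^4 is obtained without polar coordinates: |x|^2
    dominates the product of the |x_i|^(1/2), so the function is bounded by a product of four
    functions of one variable, each dominated by a multiple of an explicit derivative, and Tonelli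
    applies. Since only |chi - 1|^2 enters the energy, a Hoelder bound of exponent 1/2 for [chi] at
    0 is enough; it follows from multiplicativity and continuity at 0, and it also gives the
    measurability of T(g) F. Continuity of the cocycle needs one integrable majorant for all g near
    g0. This is why the estimates carry a rate c with c |s| <= |s t|: such a c can be kept fixed for
    t close to t0. Nontriviality is tested on scalar matrices only. There the character factor is
    chi(0) = 1, T acts isometrically, and |f(s) - f(l s)|^2 increases with l >= 1, so the limit is
    taken by monotone convergence. *)

Section density.
Local Open Scope ereal_scope.
Context d (X : measurableType d) (R : realType).
Variables (mu nu : {measure set X -> \bar R}) (w : X -> R).
Hypotheses (mw : measurable_fun setT (EFin \o w)) (w0 : forall x, (0 <= w x)%R).
Hypothesis nuE : forall A, measurable A -> nu A = \int[mu]_(x in A) (w x)%:E.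
Import HBNNSimple.

Lemma integral_density_nnsfun (h : {nnsfun X >-> R}) :
  \int[nu]_x (h x)%:E = \int[mu]_x ((h x)%:E * (w x)%:E).
Proof.
have mE r : measurable (h @^-1` [set r]) by exact: measurable_funPTI.
have ind0 r x : 0 <= (r * \1_(h @^-1` [set r]) x)%:E
  by exact: nnfun_muleindic_ge0.
have mi r : measurable_fun setT (fun x => (r * \1_(h @^-1` [set r]) x)%:E).
  by apply/measurable_EFinP; exact: measurable_funM.
under eq_integral do rewrite fimfunE -fsumEFin//.
rewrite ge0_integral_fsum//.
rewrite [RHS](_ : _ = \int[mu]_x \sum_(r \in range h)
    ((r * \1_(h @^-1` [set r]) x)%:E * (w x)%:E)); last first.
  by apply: eq_integral => x _; rewrite -ge0_mule_fsuml// fsumEFin// -fimfunE.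
rewrite ge0_integral_fsum//; last 2 first.
- by move=> r; apply: emeasurable_funM; [exact: mi|exact: mw].
- by move=> r x _; apply: mule_ge0; [exact: ind0|rewrite lee_fin].
apply: eq_fsbigr => r rh.
rewrite integralZl_indic_nnsfun// integral_indic// setIT nuE//.
have r0 : (0 <= r)%R by move: rh; rewrite inE => -[x _ <-].
under [RHS]eq_integral do rewrite EFinM -muleA.
rewrite ge0_integralZl//.
- congr (_ * _); rewrite integral_mkcond; apply: eq_integral => x _.
  by rewrite epatch_indic muleC.
- by apply: emeasurable_funM => //; exact/measurable_EFinP.
- by move=> x _; rewrite mule_ge0// lee_fin.
Qed.

(** Simple functions increase to [f], so the previous lemma passes to the limit by monotone
    convergence on both sides. Applied with [w] the indicator of [S_domain], to compute
    [ds]-integrals on R^4, and with [w] equal to |s|^(-4), to pass from [nuS] to [ds]. *)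
Lemma ge0_integral_density (f : X -> \bar R) :
  measurable_fun setT f -> (forall x, 0 <= f x) ->
  \int[nu]_x f x = \int[mu]_x (f x * (w x)%:E).
Proof.
move=> mf f0; pose h := nnsfun_approx measurableT mf.
have hf x : (h n x)%:E @[n --> \oo] --> f x.
  by apply: cvg_nnsfun_approx => // y _.
have ndh x : {homo (fun n => (h n x)%:E) : a b / (a <= b)%N >-> a <= b}.
  by move=> a b ab; rewrite lee_fin; exact/lefP/nd_nnsfun_approx.
transitivity (limn (fun n => \int[nu]_x (h n x)%:E)).
  rewrite -monotone_convergence//.
  - by apply: eq_integral => x _; exact/esym/cvg_lim.
  - by move=> n; exact/measurable_EFinP.
  - by move=> n x _; rewrite lee_fin.
under eq_fun do rewrite integral_density_nnsfun.
rewrite -monotone_convergence//.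
- apply: eq_integral => x _; apply/cvg_lim => //.
  exact: cvgeZr.
- by move=> n; apply: emeasurable_funM => //; exact/measurable_EFinP.
- by move=> n x _; rewrite mule_ge0 ?lee_fin.
- by move=> x _ a b ab; apply: lee_wpmul2r; [rewrite lee_fin|exact: ndh].
Qed.
End density.

Section affine.
Local Open Scope ereal_scope.
Variable R : realType.
Local Notation mR := (measurableTypeR R).
Local Notation leb := (@lebesgue_measure R).

Lemma measurable_affine (a b : R) :
  measurable_fun setT (fun x : mR => a * x + b : mR)%R.
Proof. by apply: measurable_funD => //; exact: measurable_funM. Qed.

Lemma ge0_integral_affine (a b : R) (f : R -> \bar R) : (0 < a)%R ->
  measurable_fun (setT : set mR) f -> (forall x, 0 <= f x) ->
  a%:E * \int[leb]_x f (a * x + b)%R = \int[leb]_x f x.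
Proof.
move=> a0 mf f0.
pose phi (x : mR) : mR := (a * x + b)%R.
have mphi : measurable_fun setT phi by exact: measurable_affine.
(* The image of Lebesgue measure under [phi], multiplied by [a], gives every half-open interval its
   length; uniqueness of Lebesgue measure then identifies the two. *)
pose m := mscale (NngNum (ltW a0)) (pushforward leb phi).
have -> : \int[leb]_x f x = \int[m mphi]_x f x.
  apply: eq_measure_integral => A mA _; apply: lebesgue_measure_unique => //.
  move=> _ /ocitvP[->|[[u v] /= uv ->]]; first by rewrite !measure0.
  rewrite /m /mscale /= /pushforward.
  have -> : phi @^-1` `]u, v] = `]((u - b) / a)%R, ((v - b) / a)%R]%classic.
    apply/seteqP; split => x /=; rewrite !in_itv /= ltr_pdivrMr// ler_pdivlMr//;
    by rewrite ltrBlDr lerBrDr mulrC.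
  rewrite !lebesgue_measure_itv/= !lte_fin uv ltr_pM2r ?invr_gt0//.
  rewrite ltrD2r uv -!EFinB -EFinM; congr EFin; field; exact: lt0r_neq0.
rewrite ge0_integral_mscale//= ge0_integral_pushforward//.
Qed.

Lemma ge0_integral_affine2 (a1 a2 b1 b2 : R) (f : mR * mR -> \bar R) :
  (0 < a1)%R -> (0 < a2)%R -> measurable_fun setT f -> (forall x, 0 <= f x) ->
  (a1 * a2)%:E * \int[lebesgue2]_x f (a1 * x.1 + b1, a2 * x.2 + b2)%R =
  \int[lebesgue2]_x f x.
Proof.
move=> a10 a20 mf f0.
have mg : measurable_fun setT
    (fun x : mR * mR => f (a1 * x.1 + b1, a2 * x.2 + b2)%R).
  apply: (measurableT_comp mf); apply/measurable_fun_pairP; split.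
    by apply: (measurableT_comp (measurable_affine _ _)).
  by apply: (measurableT_comp (measurable_affine _ _)).
rewrite [RHS](@fubini_tonelli1 _ _ _ _ _ leb leb f)//.
rewrite (@fubini_tonelli1 _ _ _ _ _ leb leb _ mg)//= /fubini_F.
rewrite -[RHS](ge0_integral_affine b1 a10); last 2 first.
- exact: (@measurable_fun_fubini_tonelli_F _ _ _ _ _ leb f mf f0).
- by move=> x; exact: integral_ge0.
rewrite EFinM -muleA; congr (_ * _); rewrite -ge0_integralZl//.
- apply: eq_integral => x _; rewrite -[RHS](ge0_integral_affine b2 a20)//.
  exact: (measurableT_comp mf (pair1_measurable _)).
- exact: (@measurable_fun_fubini_tonelli_F _ _ _ _ _ leb _ mg).
- by move=> x _; exact: integral_ge0.
- by rewrite lee_fin ltW.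
Qed.

Lemma ge0_integral_prod d1 d2 (X : measurableType d1) (Y : measurableType d2)
    (m1 : {sigma_finite_measure set X -> \bar R})
    (m2 : {sigma_finite_measure set Y -> \bar R}) f g :
  measurable_fun setT f -> measurable_fun setT g ->
  (forall x, 0 <= f x) -> (forall x, 0 <= g x) ->
  \int[m1 \x m2]_x (f x.1 * g x.2) = (\int[m1]_x f x) * (\int[m2]_x g x).
Proof.
move=> mf mg f0 g0; rewrite fubini_tonelli1//=; last 2 first.
- by apply: emeasurable_funM; exact: measurableT_comp.
- by move=> x; rewrite mule_ge0.
rewrite /fubini_F /=.
under eq_integral do rewrite ge0_integralZl//.
by rewrite ge0_integralZr// integral_ge0.
Qed.

End affine.

(** * An integrable majorant on the line *)

Section sqrtker.
Variable R : realType.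
Local Notation mR := (measurableTypeR R).
Local Notation leb := (@lebesgue_measure R).

(* On the positive half-line this is the derivative of
   x |-> - 2 / (1 + sqrt x). *)
Definition sqrtker (x : R) : R :=
  (Num.sqrt `|x|)^-1 * (1 + Num.sqrt `|x|) ^- 2.

Lemma sqrtker_ge0 x : 0 <= sqrtker x.
Proof. by rewrite mulr_ge0 ?invr_ge0 ?exprn_ge0 ?addr_ge0 ?sqrtr_ge0. Qed.

Lemma measurable_sqrtker : measurable_fun (setT : set mR) sqrtker.
Proof.
have ms : measurable_fun (setT : set mR) (fun x : mR => Num.sqrt `|x| : R).
  apply: (measurableT_comp (f := @Num.sqrt R)).
    exact: (continuous_measurable_fun (@sqrt_continuous R)).
  exact: normr_measurable.
apply: measurable_funM.
  under eq_fun do rewrite -[X in X^-1]expr1 -powR_invn ?sqrtr_ge0 //.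
  exact: (measurableT_comp (measurable_powR _) ms).
under eq_fun do rewrite -powR_invn ?addr_ge0 ?sqrtr_ge0 //.
apply: (measurableT_comp (measurable_powR _)).
by apply: measurable_funD; [exact: measurable_cst|exact: ms].
Qed.

(** The integral is 2 / (1 + sqrt e). A bound independent of [e] is what allows [e] to tend to 0
    afterwards. *)
Lemma integral_sqrtker_ge (e : R) : 0 < e ->
  (\int[leb]_(x in `[e, +oo[) (sqrtker x)%:E <= 2%:E)%E.
Proof.
move=> e0.
pose F (x : R) : R := - 2 * (1 + Num.sqrt x)^-1.
pose f (x : R) : R := (Num.sqrt x)^-1 * (1 + Num.sqrt x) ^- 2.
have s0 (x : R) : 0 < 1 + Num.sqrt x by rewrite ltr_pwDl ?sqrtr_ge0.
have dF (x : R) : 0 < x -> is_derive x 1 F (f x).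
  move=> x0.
  have h1 : is_derive x 1 (fun y => 1 + Num.sqrt y : R) ((2 * Num.sqrt x)^-1).
    rewrite -[X in is_derive _ _ _ X]add0r.
    by apply: is_deriveD; exact: is_derive1_sqrt.
  have h2 := @is_deriveV R (fun y => 1 + Num.sqrt y) x _ 1 (lt0r_neq0 (s0 x))
    h1.
  have := is_deriveZ (- 2 : R) h2.
  move/is_derive_eq; apply.
  rewrite /f /GRing.scale /=; field.
  by rewrite !gt_eqF// sqrtr_gt0.
rewrite (_ : (\int[leb]_(x in `[e, +oo[) (sqrtker x)%:E)%E =
    (\int[leb]_(x in `[e, +oo[) (f x)%:E)%E); last first.
  apply: eq_integral => x; rewrite inE/= in_itv/= andbT => ex.
  by rewrite /sqrtker ger0_norm// (le_trans (ltW e0) ex).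
rewrite (@ge0_continuous_FTC2y _ f F e 0).
- rewrite add0e -EFinN lee_fin /F mulNr opprK -[leRHS]mulr1 ler_pM2l//.
  by rewrite invf_le1// lerDl sqrtr_ge0.
- by move=> x _; rewrite /f mulr_ge0 ?invr_ge0 ?exprn_ge0 ?addr_ge0 ?sqrtr_ge0.
- apply: continuous_in_subspaceT => x; rewrite inE/= in_itv/= andbT => ex.
  have x0 := lt_le_trans e0 ex.
  have cs : {for x, continuous (@Num.sqrt R)} by exact: sqrt_continuous.
  apply: cvgM; first by apply: cvgV => //; rewrite gt_eqF// sqrtr_gt0.
  apply: cvgV; first by rewrite gt_eqF// exprn_gt0.
  have c1 : {for x, continuous (fun y : R => 1 + Num.sqrt y)}.
    by apply: cvgD => //; exact: cvg_cst.
  exact: (cvgM c1 c1).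
- apply/cvgrPdist_lt => r r0; near=> x.
  rewrite sub0r normrN /F normrM normrN normfV !gtr0_norm//.
  rewrite ltr_pdivrMr// -ltr_pdivrMl// mulrC.
  have xr : (2 / r) ^+ 2 < x by near: x; apply: nbhs_pinfty_gt; exact: num_real.
  have : 2 / r < Num.sqrt x.
    rewrite -[ltLHS]gtr0_norm ?divr_gt0// -sqrtr_sqr ltr_sqrt//.
  by move=> /lt_trans; apply; rewrite ltrDr.
- by move=> x ex; have [] := dF _ (lt_trans e0 ex).
- apply: cvg_at_right_filter.
  by have [/derivable1_diffP/differentiable_continuous] := dF _ e0.
- move=> x; rewrite in_itv/= andbT => ex.
  by rewrite derive1E; have [_] := dF _ (lt_trans e0 ex).
Unshelve. all: by end_near. Qed.

Lemma integral_sqrtker : (\int[leb]_x (sqrtker x)%:E <= 4%:E)%E.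
Proof.
pose k x := (sqrtker x)%:E.
have mk D : measurable_fun (D : set mR) k.
  by apply: measurable_funTS; apply/measurable_EFinP; exact: measurable_sqrtker.
have k0 x : (0 <= k x)%E by rewrite lee_fin sqrtker_ge0.
pose e n : R := n.+1%:R^-1.
have e0 n : 0 < e n by rewrite invr_gt0.
(* Both half-lines are cut at distance 1/(n+1) from the singularity 0; by symmetry each contributes
   at most 2, whence the bound 4. *)
pose D n : set mR := `]-oo, - e n] `|` `[e n, +oo[.
have D0 : \bigcup_n D n = setT `\ 0.
  apply/seteqP; split=> x /=.
    move=> [n _]; rewrite /D /= !in_itv/= andbT => -[xn|nx]; split=> // x0.
      by move: xn; rewrite x0 oppr_ge0 leNgt e0.
    by move: nx; rewrite x0 leNgt e0.
  move=> [_ /eqP x0].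
  have [n nx] : exists n, e n <= `|x|.
    have x1 : 0 < `|x| by rewrite normr_gt0.
    have [n _ /(_ n (leqnn n)) /= nx] := near_infty_natSinv_lt (PosNum x1).
    by exists n; exact: ltW.
  exists n => //; rewrite /D /= !in_itv /= andbT.
  by move: nx; rewrite ler_normr lerNr => /orP[->|->]; [right|left].
have mD n : measurable (D n) by apply: measurableU.
have ndD : nondecreasing_seq D.
  move=> m n mn; apply/subsetPset => x; rewrite /D /= !in_itv/= !andbT.
  have nm : e n <= e m by rewrite lef_pV2 ?posrE// ler_nat.
  move=> [xm|mx]; [left|right].
    by rewrite (le_trans xm)// lerN2.
  exact: le_trans mx.
have -> : (\int[leb]_x (sqrtker x)%:E = \int[leb]_(x in \bigcup_n D n) k x)%E.
  rewrite D0 (integral_setD1 (f := k) (r := 0))//; last exact: mk.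
  exact: measurableD.
have := @ge0_nondecreasing_set_cvg_integral _ _ _ D k leb ndD mD
  (fun i => mk (D i)) (fun i x _ => k0 x).
move=> /cvg_lim <-//; apply: lime_le.
  apply: ereal_nondecreasing_is_cvgn.
  exact: (@ge0_nondecreasing_set_nondecreasing_integral _ _ _ D k leb ndD mD
  (fun i => mk (D i)) (fun i x _ => k0 x)).
apply: nearW => n; rewrite /D ge0_integral_setU//=; last first.
  apply/disj_setPS => x [] /=; rewrite !in_itv/= andbT => xn nx.
  by have := e0 n; lra.
have -> : 4%:E = (2%:E + 2%:E)%E :> \bar R by rewrite -EFinD; congr EFin; ring.
apply: leeD; last exact: integral_sqrtker_ge.
apply: le_trans (integral_sqrtker_ge (e0 n)).
rewrite (_ : (\int[leb]_(x in `[e n, +oo[) (sqrtker x)%:E)%E =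
  (\int[leb]_(x in `[e n, +oo[) k (- x)%R)%E); last first.
  by apply: eq_integral => x _; rewrite /k /sqrtker normrN.
have Nm : measurable_fun setT (-%R : mR -> mR) by exact: oppr_measurable.
rewrite (_ : `[e n, +oo[%classic = (-%R : mR -> mR) @^-1` `]-oo, - e n]);
  last first.
  by apply/seteqP; split=> x /=; rewrite !in_itv/= andbT lerN2.
rewrite -(@ge0_integral_pushforward _ _ _ _ _ _ Nm leb _ k)//.
rewrite le_eqVlt; apply/orP; left; apply/eqP.
by apply: eq_measure_integral => A mA _; rewrite -[LHS]lebesgue_measureN.
Qed.


(* sqrtker has the junk value 0 at 0; the pointwise bound on the whole of R^4
   needs +oo there. *)
Definition sqrtkere (x : R) : \bar R :=
  if x == 0 then +oo%E else (sqrtker x)%:E.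

Lemma sqrtkere_gt0 x : (0 < sqrtkere x)%E.
Proof.
rewrite /sqrtkere; case: ifPn => // x0; rewrite lte_fin.
by rewrite mulr_gt0 ?invr_gt0 ?exprn_gt0 ?ltr_pwDl ?sqrtr_ge0//
  sqrtr_gt0 normr_gt0.
Qed.

Lemma measurable_sqrtkere : measurable_fun (setT : set mR) sqrtkere.
Proof.
apply: measurable_fun_ifT => //.
- exact: measurable_fun_eqr.
- by apply/measurable_EFinP; exact: measurable_sqrtker.
Qed.

Lemma integral_sqrtkere : (\int[leb]_x sqrtkere x <= 4%:E)%E.
Proof.
apply: le_trans integral_sqrtker.
rewrite -(@integral_setD1 _ _ 0 setT)//; last 2 first.
- exact: measurableD.
- by apply: measurable_funTS; exact: measurable_sqrtkere.
rewrite -[leRHS](@integral_setD1 _ _ 0 setT)//; last 2 first.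
- exact: measurableD.
- by apply: measurable_funTS; apply/measurable_EFinP; exact: measurable_sqrtker.
rewrite le_eqVlt; apply/orP; left; apply/eqP; apply: eq_integral => x.
by rewrite inE /sqrtkere => -[_ /eqP/negbTE ->].
Qed.

(** With y = sqrt |x|, it suffices to chain (1 + y)^2 <= 2 (1 + y^2) <= 2 (1 + 1/c) (1 + c y^2) with
    1 + c y^2 <= e^(c y^2). *)
Lemma expR_sqrtker (c x : R) : 0 < c -> 
  (Num.sqrt `|x|)^-1 * expR (- (c * `|x|)) <= 2 * (1 + c^-1) * sqrtker x.
Proof.
move=> c0; rewrite /sqrtker mulrCA ler_wpM2l// ?invr_ge0 ?sqrtr_ge0//.
rewrite expRN ler_pdivlMr ?exprn_gt0 ?ltr_pwDl ?sqrtr_ge0//.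
rewrite mulrC ler_pdivrMr ?expR_gt0//.
set y := Num.sqrt `|x|.
have -> : `|x| = y ^+ 2 by rewrite sqr_sqrtr.
have h1 : (1 + y) ^+ 2 <= 2 * (1 + y ^+ 2) by have := sqr_ge0 (1 - y); lra.
have h2 := expR_ge1Dx (c * y ^+ 2).
apply: (le_trans h1); rewrite -mulrA ler_pM2l//.
apply: (@le_trans _ _ ((1 + c^-1) * (1 + c * y ^+ 2))).
  rewrite mulrDl mul1r (mulrDr c^-1) mulr1 mulKf ?gt_eqF//.
  have := sqr_ge0 y; have : 0 < c^-1 by rewrite invr_gt0.
  have : 0 <= c * y ^+ 2 by rewrite mulr_ge0 ?sqr_ge0 ?ltW.
  lra.
by rewrite ler_wpM2l// addr_ge0// invr_ge0 ltW.
Qed.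

(** Singularity and decay are both shared equally among the coordinates. The factor |x|^(-2) is at
    most the product of the |x_i|^(-1/2), each integrable at 0; and |x| is at least a quarter of the
    sum of the |x_i|, which produces the rate c / 4 and the fourth power of the constant of
    [expR_sqrtker]. Zero coordinates are excluded because the inverse of 0 is 0. *)
Lemma radial_le_sqrtker (c a b p q r2 : R) : 0 < c ->
  a != 0 -> b != 0 -> p != 0 -> q != 0 ->
  r2 = a ^+ 2 + b ^+ 2 + (p ^+ 2 + q ^+ 2) ->
  r2^-1 * expR (- (c * Num.sqrt r2)) <=
  (2 * (1 + (c / 4)^-1)) ^+ 4 *
  ((sqrtker a * sqrtker b) * (sqrtker p * sqrtker q)).
Proof.
move=> c0 a0 b0 p0 q0 r2E.
have c40 : 0 < c / 4 by rewrite divr_gt0.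
pose A := Num.sqrt `|a|; pose B := Num.sqrt `|b|.
pose P := Num.sqrt `|p|; pose Q := Num.sqrt `|q|.
have sE (x : R) : x ^+ 2 = (Num.sqrt `|x|) ^+ 2 ^+ 2.
  by rewrite sqr_sqrtr ?normr_ge0// real_normK ?num_real.
have [A0 B0 P0 Q0] : [/\ 0 < A, 0 < B, 0 < P & 0 < Q].
  by rewrite !sqrtr_gt0 !normr_gt0.
(* AM-GM, twice *)
have r2_ge : A * B * (P * Q) <= r2.
  rewrite r2E (sE a) (sE b) (sE p) (sE q) -/A -/B -/P -/Q.
  have h1 := sqr_ge0 (A ^+ 2 - B ^+ 2); have h2 := sqr_ge0 (P ^+ 2 - Q ^+ 2).
  have h3 := sqr_ge0 (A * B - P * Q).
  have h4 : 0 <= A * B * (P * Q) by rewrite !mulr_ge0 ?ltW.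
  lra.
have r20 : 0 < r2 by apply: lt_le_trans r2_ge; rewrite !mulr_gt0.
have ler (x : R) : x ^+ 2 <= r2 -> `|x| <= Num.sqrt r2.
  by move=> xr; rewrite -sqrtr_sqr ler_wsqrtr.
have sq2 (x y : R) : x ^+ 2 <= x ^+ 2 + y ^+ 2 by rewrite lerDl sqr_ge0.
have ss (x y u v : R) : x ^+ 2 + y ^+ 2 <= x ^+ 2 + y ^+ 2 + (u ^+ 2 + v ^+ 2).
  by rewrite lerDl addr_ge0 ?sqr_ge0.
have ha : `|a| <= Num.sqrt r2.
  by apply: ler; rewrite r2E (le_trans (sq2 a b)).
have hb : `|b| <= Num.sqrt r2.
  by apply: ler; rewrite r2E (addrC (a ^+ 2)) (le_trans (sq2 b a)).
have hp : `|p| <= Num.sqrt r2.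
  by apply: ler; rewrite r2E addrC (le_trans (sq2 p q)).
have hq : `|q| <= Num.sqrt r2.
  by apply: ler; rewrite r2E addrC (addrC (p ^+ 2)) (le_trans (sq2 q p)).
pose E (x : R) : R := (Num.sqrt `|x|)^-1 * expR (- (c / 4 * `|x|)).
have E0 x : 0 <= E x by rewrite mulr_ge0 ?invr_ge0 ?sqrtr_ge0 ?expR_ge0.
apply: (@le_trans _ _ ((E a * E b) * (E p * E q))).
  have -> : (E a * E b) * (E p * E q) = (A * B * (P * Q))^-1 *
      expR (- (c / 4 * (`|a| + `|b| + `|p| + `|q|))).
    rewrite !mulrDr !opprD !expRD /E -/A -/B -/P -/Q; field.
    by rewrite !gt_eqF.
  apply: ler_pM; rewrite ?invr_ge0 ?expR_ge0 ?(ltW r20)//.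
    by rewrite lef_pV2 ?posrE// !mulr_gt0.
  have : `|a| + `|b| + `|p| + `|q| <= 4 * Num.sqrt r2.
    by move: ha hb hp hq; clear; lra.
  move=> h; rewrite ler_expR lerN2.
  by apply: (le_trans (ler_wpM2l (ltW c40) h)); rewrite mulrA divfK.
have -> : (2 * (1 + (c / 4)^-1)) ^+ 4 *
    ((sqrtker a * sqrtker b) * (sqrtker p * sqrtker q)) =
  (2 * (1 + (c / 4)^-1) * sqrtker a * (2 * (1 + (c / 4)^-1) * sqrtker b)) *
  (2 * (1 + (c / 4)^-1) * sqrtker p * (2 * (1 + (c / 4)^-1) * sqrtker q)).
  by ring.
by do 2?apply: ler_pM; rewrite ?mulr_ge0 ?E0//; exact: expR_sqrtker.
Qed.

End sqrtker.

(** * Translations and dilations of S *)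

Section translation.
Variable R : realType.
Local Notation C := R[i].
Local Notation mR := (measurableTypeR R).
Implicit Types (s t : lowS R) (x : R4 R).

(** The product of two lower triangular matrices in the coordinates [S_coord], extended to all of
    R^4. Without positivity it is bilinear, so the change of variables can be done on R^4, and [y]
    may be a difference of two elements of S. *)
Definition coord_mul (x y : R4 R) : R4 R :=
  ((y.1.1 * x.1.1, y.1.2 * x.1.2),
   (y.1.1 * x.2.1 + x.1.2 * y.2.1, y.1.1 * x.2.2 + x.1.2 * y.2.2)).

Lemma S_coord_domain s : S_domain (S_coord s).
Proof.
by have /and3P[_] := smxP s; rewrite !ltcE => /andP[_ ?] /andP[_ ?]; split.
Qed.

Lemma S_coord_real s : s 0 0 = ((S_coord s).1.1)%:C%C /\
  s 1 1 = ((S_coord s).1.2)%:C%C.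
Proof.
have /and3P[_] := smxP s; rewrite /S_coord /=.
case: (s 0 0) => a b; case: (s 1 1) => c d; rewrite !ltcE /=.
by move=> /andP[/eqP -> _] /andP[/eqP -> _].
Qed.

Lemma S_coord_mul s t : S_coord (mulS s t) = coord_mul (S_coord s) (S_coord t).
Proof.
have e1 : lift ord0 ord0 = 1 :> 'I_2 by apply: val_inj.
have [s0 s1] := S_coord_real s; have [t0 t1] := S_coord_real t.
have /and3P[/eqP t01 _ _] := smxP t; have /and3P[/eqP s01 _ _] := smxP s.
rewrite [LHS]/S_coord /= !mxE !big_ord_recl !big_ord0 /= !e1.
rewrite s0 s1 t0 t1 t01 s01 /coord_mul /=.
rewrite /S_coord /=; case: (s 1 0) => a b; case: (t 1 0) => c d /=.
rewrite s0 s1 t0 t1 /=.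
congr (_, _, (_, _)); ring.
Qed.

Lemma coord_mul_domain x y : S_domain y ->
  (S_domain (coord_mul x y) <-> S_domain x).
Proof. by move=> [y1 y2]; rewrite /S_domain /coord_mul /= !pmulr_rgt0. Qed.

Lemma S_of_coord_mul x t : S_domain x ->
  S_of_coord (coord_mul x (S_coord t)) = mulS (S_of_coord x) t.
Proof.
by move=> Dx; rewrite -[RHS]S_coordK S_coord_mul S_of_coordK.
Qed.

Lemma measurable_coord_mul y :
  measurable_fun setT (fun x : R4 R => coord_mul x y).
Proof.
have p1 : measurable_fun setT (fun x : R4 R => x.1.1 : mR).
  exact: (measurableT_comp measurable_fst measurable_fst).
have p2 : measurable_fun setT (fun x : R4 R => x.1.2 : mR).
  exact: (measurableT_comp measurable_snd measurable_fst).
have p3 : measurable_fun setT (fun x : R4 R => x.2.1 : mR).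
  exact: (measurableT_comp measurable_fst measurable_snd).
have p4 : measurable_fun setT (fun x : R4 R => x.2.2 : mR).
  exact: (measurableT_comp measurable_snd measurable_snd).
apply/measurable_fun_pairP; split; apply/measurable_fun_pairP; split => /=.
- exact: measurable_funM.
- exact: measurable_funM.
- by apply: measurable_funD; apply: measurable_funM.
- by apply: measurable_funD; apply: measurable_funM.
Qed.

(** The diagonal coordinates are scaled by y_11 and y_22. Once they are fixed, the two off-diagonal
    ones undergo an affine map with slope y_11, the shift depending on the fixed x_22. Tonelli thus
    gives the Jacobian y_11^3 y_22. *)
Lemma ge0_integral_coord_mul (y : R4 R) (G : R4 R -> \bar R) : S_domain y ->
  measurable_fun setT G -> (forall x, (0 <= G x)%E) ->
  ((y.1.1 * y.1.2 * (y.1.1 * y.1.1))%:E * \int[lebesgue4]_x G (coord_mul x y)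
   = \int[lebesgue4]_x G x)%E.
Proof.
move=> [y1 y2] mG G0.
have mGa : measurable_fun setT (fun x : R4 R => G (coord_mul x y)).
  exact: (measurableT_comp mG (measurable_coord_mul y)).
pose m := @lebesgue2 R.
rewrite [RHS](@fubini_tonelli1 _ _ _ _ _ m m G)//.
rewrite (@fubini_tonelli1 _ _ _ _ _ m m _ mGa)//= /fubini_F.
rewrite -[RHS](ge0_integral_affine2 0 0 y1 y2); last 2 first.
- exact: (@measurable_fun_fubini_tonelli_F _ _ _ _ _ m G mG).
- by move=> u; exact: integral_ge0.
rewrite EFinM -muleA; congr (_ * _)%E; rewrite -ge0_integralZl//; last 3 first.
- exact: (@measurable_fun_fubini_tonelli_F _ _ _ _ _ m _ mGa).
- by move=> u _; exact: integral_ge0.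
- by rewrite lee_fin mulr_ge0 ?ltW.
apply: eq_integral => u _.
rewrite -[RHS](ge0_integral_affine2 (u.2 * y.2.1) (u.2 * y.2.2) y1 y1)//.
- by rewrite /coord_mul /= !addr0.
- exact: (measurableT_comp mG (pair1_measurable _)).
Qed.

Lemma ge0_integral_ds (F : lowS R -> \bar R) : measurable_fun setT F ->
  (forall s, (0 <= F s)%E) ->
  (\int[@ds R]_s F s =
   \int[lebesgue4]_x (F (S_of_coord x) * (\1_(@S_domain R) x)%:E))%E.
Proof.
move=> mF F0.
have mFc : measurable_fun setT (fun x : R4 R => F (S_of_coord x)).
  exact: (measurableT_comp mF (@measurable_S_of_coord R)).
pose m := mrestr (@lebesgue4 R) (@measurable_S_domain R).
pose pm := pushforward m (@S_of_coord R).
transitivity (\int[pm]_s F s)%E.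
  by apply: eq_measure_integral => A mA _.
have pmE := @ge0_integral_pushforward _ _ _ _ _ _
  (@measurable_S_of_coord R) m setT F
  measurableT mF (fun s _ => F0 s).
apply: (eq_trans pmE).
rewrite preimage_setT.
have mE A : measurable A ->
    m A = (\int[lebesgue4]_(x in A) (\1_(@S_domain R) x)%:E)%E.
  move=> mA; rewrite /m /mrestr integral_indic;
    last exact: (@measurable_S_domain R).
    by rewrite setIC.
  exact: mA.
have m1 : measurable_fun (setT : set (R4 R))
    (fun x => (\1_(@S_domain R) x : R)%:E).
  apply/measurable_EFinP; apply: measurable_indic;
    exact: (@measurable_S_domain R).
have i0 x : 0 <= \1_(@S_domain R) x :> R by [].
exact: (@ge0_integral_density _ _ _ lebesgue4 m (\1_(@S_domain R)) m1 i0 mE _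
  mFc).
Qed.

Lemma measurable_mulS t : measurable_fun setT (fun s : lowS R => mulS s t).
Proof.
have -> : (fun s => mulS s t) =
    @S_of_coord R \o (fun x => coord_mul x (S_coord t)) \o @S_coord R.
  by apply/funext => s /=; rewrite -S_coord_mul S_coordK.
apply: measurableT_comp; last exact: measurable_S_coord.
apply: measurableT_comp; last exact: measurable_coord_mul.
exact: measurable_S_of_coord.
Qed.

Lemma ge0_integral_ds_mulS t (F : lowS R -> \bar R) : measurable_fun setT F ->
  (forall s, (0 <= F s)%E) ->
  (((S_coord t).1.1 * (S_coord t).1.2 *
     ((S_coord t).1.1 * (S_coord t).1.1))%:E *
   \int[@ds R]_s F (mulS s t) = \int[@ds R]_s F s)%E.
Proof.
move=> mF F0; have Dt := S_coord_domain t.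
rewrite !ge0_integral_ds//;
  last exact: (measurableT_comp mF (measurable_mulS t)).
rewrite -[RHS](ge0_integral_coord_mul Dt); last 2 first.
- apply: emeasurable_funM.
    exact: (measurableT_comp mF (@measurable_S_of_coord R)).
  by apply/measurable_EFinP; apply: measurable_indic;
    exact: (@measurable_S_domain R).
- by move=> x; rewrite mule_ge0// lee_fin.
congr (_ * _)%E; apply: eq_integral => x _; rewrite !indicE.
(* The default value of [S_of_coord] outside S does no harm: right translation preserves [S_domain]
   and its complement, and on the complement both indicators vanish. *)
have [Dx|nDx] := pselect (S_domain x).
  by rewrite !mem_set ?S_of_coord_mul//; exact/coord_mul_domain.
rewrite !memNset ?mule0//.
by move/(coord_mul_domain _ Dt).
Qed.

Lemma ge0_integral_nu (F : lowS R -> \bar R) : measurable_fun setT F ->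
  (forall s, (0 <= F s)%E) ->
  (\int[@nuS R]_s F s = \int[@ds R]_s (F s * (S_norm s ^- 4)%:E))%E.
Proof.
move=> mF F0; apply: ge0_integral_density => //.
  exact: measurable_nu_density.
by move=> s; rewrite invr_ge0 exprn_ge0 ?sqrtr_ge0.
Qed.

End translation.

(** * The Euclidean norm on S under right translations *)

Section norm4.
Variable R : realType.
Implicit Types (x y z : R4 R) (s t : lowS R).

Definition sq4 x : R := x.1.1 ^+ 2 + x.1.2 ^+ 2 + (x.2.1 ^+ 2 + x.2.2 ^+ 2).
Definition norm4 x : R := Num.sqrt (sq4 x).
Definition sub4 x y : R4 R :=
  ((x.1.1 - y.1.1, x.1.2 - y.1.2), (x.2.1 - y.2.1, x.2.2 - y.2.2)).

Lemma sq4_ge0 x : 0 <= sq4 x.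
Proof. by rewrite !addr_ge0 ?sqr_ge0. Qed.

Lemma norm4_sq x : norm4 x ^+ 2 = sq4 x.
Proof. by rewrite sqr_sqrtr ?sq4_ge0. Qed.

Lemma norm4_ge0 x : 0 <= norm4 x.
Proof. exact: sqrtr_ge0. Qed.

Lemma S_normE s : S_norm s = norm4 (S_coord s).
Proof. by rewrite /S_norm S_norm_sqE. Qed.

Lemma S_norm_gt0 s : 0 < S_norm s.
Proof.
have [s0 _] := S_coord_domain s.
rewrite S_normE sqrtr_gt0 /sq4 -addrA ltr_pwDl ?exprn_gt0//.
by rewrite !addr_ge0 ?sqr_ge0.
Qed.

(** Submultiplicativity of the Hilbert-Schmidt norm, with the difference of the squares displayed as
    a sum of squares. It is needed on all of R^4, since it will be applied with [y] a difference of
    elements of S. *)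
Lemma norm4_mul x y : norm4 (coord_mul x y) <= norm4 x * norm4 y.
Proof.
rewrite -sqrtrM ?sq4_ge0// ler_wsqrtr//.
case: x => -[a b] [p q]; case: y => -[a' b'] [p' q'].
rewrite /coord_mul /sq4 /= -subr_ge0.
set e := (X in 0 <= X).
have -> : e = (p * p' + q * q' - b * a') ^+ 2 + (p * q' - q * p') ^+ 2 +
  (a * b') ^+ 2 + (a * p') ^+ 2 + (a * q') ^+ 2 + (p * b') ^+ 2 + (q * b') ^+ 2.
  by rewrite /e; ring.
by rewrite !addr_ge0 ?sqr_ge0.
Qed.

Lemma sub4_mul x y z :
  sub4 (coord_mul x y) (coord_mul x z) = coord_mul x (sub4 y z).
Proof. rewrite /sub4 /coord_mul /=; congr (_, _, (_, _)); ring. Qed.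

Lemma norm4_sub x y : norm4 x <= norm4 y + norm4 (sub4 x y).
Proof.
rewrite -(@ler_pXn2r _ 2) ?nnegrE ?addr_ge0 ?norm4_ge0//.
rewrite sqrrD !norm4_sq.
(* The left-hand side is the inner product of y and x - y, so this is the Cauchy-Schwarz inequality;
   the six squares below are those of Lagrange's identity. *)
suff : (sq4 x - sq4 y - sq4 (sub4 x y)) / 2 <= norm4 y * norm4 (sub4 x y).
  rewrite ler_pdivrMr//; set m := norm4 y * _; rewrite -mulr_natr; lra.
apply: le_trans (ler_norm _) _.
rewrite -(@ler_pXn2r _ 2) ?nnegrE ?mulr_ge0 ?norm4_ge0//.
rewrite exprMn !norm4_sq real_normK ?num_real//.
case: x => -[a b] [p q]; case: y => -[a' b'] [p' q'].
rewrite /sq4 /sub4 /= -subr_ge0.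
set e := (X in 0 <= X).
have -> : e = (a' * (b - b') - b' * (a - a')) ^+ 2 +
  (a' * (p - p') - p' * (a - a')) ^+ 2 + (a' * (q - q') - q' * (a - a')) ^+ 2 +
  (b' * (p - p') - p' * (b - b')) ^+ 2 + (b' * (q - q') - q' * (b - b')) ^+ 2 +
  (p' * (q - q') - q' * (p - p')) ^+ 2.
  by rewrite /e; field.
by rewrite !addr_ge0 ?sqr_ge0.
Qed.

Lemma norm4_subC x y : norm4 (sub4 x y) = norm4 (sub4 y x).
Proof. by congr Num.sqrt; rewrite /sq4 /sub4 /=; ring. Qed.

Lemma S_norm_mul s t : S_norm (mulS s t) <= S_norm s * S_norm t.
Proof. by rewrite !S_normE S_coord_mul norm4_mul. Qed.

(** By linearity of the product in its second factor, st - su is s times t - u. This is the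
    Lipschitz estimate behind that of T(t) f in t. *)
Lemma S_norm_mul_dist s t u :
  `|S_norm (mulS s t) - S_norm (mulS s u)| <=
  S_norm s * norm4 (sub4 (S_coord t) (S_coord u)).
Proof.
rewrite !S_normE !S_coord_mul; set x := S_coord s.
apply: le_trans (norm4_mul _ _); rewrite -sub4_mul.
have h1 := norm4_sub (coord_mul x (S_coord t)) (coord_mul x (S_coord u)).
have h2 := norm4_sub (coord_mul x (S_coord u)) (coord_mul x (S_coord t)).
by rewrite norm4_subC in h2; rewrite ler_norml; apply/andP; split; lra.
Qed.

Lemma mulSA s t u : mulS s (mulS t u) = mulS (mulS s t) u.
Proof. by apply: val_inj; rewrite /= mulmxA. Qed.

Lemma mulS1 s : mulS s (oneS R) = s.
Proof. by apply: val_inj; rewrite /= mulmx1. Qed.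

Lemma mulSV s : mulS s (Defs.invS s) = oneS R.
Proof. by apply: val_inj; rewrite /= mulmxV// S_unitmx. Qed.

Lemma S_norm_mul_ge s t : S_norm s / S_norm (Defs.invS t) <= S_norm (mulS s t).
Proof.
rewrite ler_pdivrMr ?S_norm_gt0//; apply: le_trans (S_norm_mul _ _).
by rewrite -mulSA mulSV mulS1.
Qed.

Lemma ge0_integral_nu_mulS_le t : exists2 K : R, 0 <= K &
  forall F : lowS R -> \bar R,
  measurable_fun setT F -> (forall s, (0 <= F s)%E) ->
  (\int[@nuS R]_s F (mulS s t) <= K%:E * \int[@nuS R]_s F s)%E.
Proof.
pose J := (S_coord t).1.1 * (S_coord t).1.2 *
  ((S_coord t).1.1 * (S_coord t).1.1).
have J0 : 0 < J by have [? ?] := S_coord_domain t; rewrite !mulr_gt0.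
(* Translation by t multiplies [ds] by the Jacobian J, and |s t| <= |s| |t| gives |s|^(-4) <= |t|^4
   |s t|^(-4). *)
exists (S_norm t ^+ 4 * J^-1).
  by rewrite mulr_ge0 ?exprn_ge0 ?invr_ge0 ?(ltW J0) ?(ltW (S_norm_gt0 _)).
move=> F mF F0.
have mFt := measurableT_comp mF (measurable_mulS t).
have md := @measurable_nu_density R.
have mdt := measurableT_comp md (measurable_mulS t).
have d0 s : (0 <= (S_norm s ^- 4)%:E :> \bar R)%E.
  by rewrite lee_fin invr_ge0 exprn_ge0// ltW// S_norm_gt0.
rewrite !ge0_integral_nu//.
rewrite -(ge0_integral_ds_mulS t (F := fun s => F s * (S_norm s ^- 4)%:E)%E);
  last 2 first.
- exact: emeasurable_funM.
- by move=> s; exact: mule_ge0.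
rewrite -/J muleA -EFinM divfK ?gt_eqF//.
rewrite -ge0_integralZl//; last 3 first.
- exact: emeasurable_funM.
- by move=> s _; exact: mule_ge0.
- by rewrite lee_fin exprn_ge0// ltW// S_norm_gt0.
apply: ge0_le_integral => //.
- by move=> s _; exact: mule_ge0.
- exact: emeasurable_funM.
- by apply: measurable_funeM; exact: emeasurable_funM.
move=> s _; rewrite muleCA; apply: lee_wpmul2l; first exact: F0.
rewrite -EFinM lee_fin ler_pdivlMr ?exprn_gt0 ?S_norm_gt0//.
rewrite mulrC ler_pdivrMr ?exprn_gt0 ?S_norm_gt0// -exprMn.
by rewrite lerXn2r ?nnegrE ?mulr_ge0 ?(ltW (S_norm_gt0 _))// mulrC S_norm_mul.
Qed.

End norm4.

(** * Dilations of S and the basic integrable function *)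

Section dilation.
Variable R : realType.
Implicit Types (s t : lowS R) (l c : R).

Definition dilS l : lowS R := S_of_coord ((l, l), (0, 0)).

Lemma S_coord_dil l : 0 < l -> S_coord (dilS l) = ((l, l), (0, 0)).
Proof. by move=> l0; rewrite S_of_coordK. Qed.

Lemma S_norm_dil s l : 0 < l -> S_norm (mulS s (dilS l)) = l * S_norm s.
Proof.
move=> l0; rewrite !S_normE S_coord_mul S_coord_dil//.
rewrite -[X in X * _](ger0_norm (ltW l0)) -sqrtr_sqr -sqrtrM ?sqr_ge0//.
by congr Num.sqrt; rewrite /sq4 /coord_mul /=; ring.
Qed.

(** The Jacobian l^4 cancels the factor l^(-4) gained by the density: the exponent 4 in [nuS] is the
    real dimension of S. *)
Lemma ge0_integral_nu_dil l (F : lowS R -> \bar R) : 0 < l ->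
  measurable_fun setT F -> (forall s, (0 <= F s)%E) ->
  (\int[@nuS R]_s F (mulS s (dilS l)) = \int[@nuS R]_s F s)%E.
Proof.
move=> l0 mF F0; set t := dilS l.
have mFt := measurableT_comp mF (measurable_mulS t).
have md := @measurable_nu_density R.
have d0 s : (0 <= (S_norm s ^- 4)%:E :> \bar R)%E.
  by rewrite lee_fin invr_ge0 exprn_ge0// ltW// S_norm_gt0.
rewrite !ge0_integral_nu//.
rewrite -[RHS](ge0_integral_ds_mulS t
  (F := fun s => F s * (S_norm s ^- 4)%:E)%E); last 2 first.
- exact: emeasurable_funM.
- by move=> s; exact: mule_ge0.
rewrite S_coord_dil//= -ge0_integralZl//; last 3 first.
- exact: (measurableT_comp (emeasurable_funM mF md) (measurable_mulS t)).
- by move=> s _; exact: mule_ge0.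
- by rewrite lee_fin !mulr_ge0 ?ltW.
apply: eq_integral => s _; rewrite muleCA -EFinM S_norm_dil//.
by congr (_ * _%:E)%E; field; rewrite !gt_eqF ?S_norm_gt0.
Qed.

(** If S were [nuS]-null, the integral of |s|^4 against [nuS] would vanish; but it equals the
    [ds]-measure of S, which is infinite. *)
Lemma nuS_setT_neq0 : @nuS R setT != 0%E.
Proof.
apply/eqP => nu0.
have mN4 : measurable_fun setT (fun s : lowS R => (S_norm s ^+ 4)%:E).
  by apply/measurable_EFinP; apply: measurable_funX; exact: measurable_S_norm.
have N4 s : (0 <= (S_norm s ^+ 4)%:E :> \bar R)%E.
  by rewrite lee_fin exprn_ge0// ltW// S_norm_gt0.
have : (\int[@nuS R]_s (S_norm s ^+ 4)%:E = @ds R setT)%E.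
  rewrite ge0_integral_nu// -[RHS]mul1e -integral_cst//.
  apply: eq_integral => s _; rewrite -EFinM mulfV// gt_eqF// exprn_gt0//.
  exact: S_norm_gt0.
rewrite null_set_integral//.
rewrite /ds /pushforward /mrestr preimage_setT setTI.
have -> : @S_domain R = (`]0, +oo[ `*` `]0, +oo[) `*` setT :> set (R4 R).
  apply/seteqP; split=> -[[a b] c] /=; rewrite !in_itv /= !andbT.
    by move=> [? ?].
  by move=> [[? ?] _].
pose leb := @lebesgue_measure R.
have l2 (A B : set (measurableTypeR R)) : measurable A -> measurable B ->
    @lebesgue2 R (A `*` B) = (leb A * leb B)%E.
  exact: product_measure1E.
have l4 (A B : set (measurableTypeR R * measurableTypeR R)) :
    measurable A -> measurable B ->
    @lebesgue4 R (A `*` B) = (@lebesgue2 R A * @lebesgue2 R B)%E.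
  exact: product_measure1E.
rewrite l4//; last exact: measurableX.
have -> : [set: measurableTypeR R * measurableTypeR R] = setT `*` setT.
  by rewrite setXTT.
rewrite !l2// -!set_itvE /leb !lebesgue_measure_itv/= ltry/=.
by rewrite oppr0 adde0 addye// !mulyy.
Qed.

Lemma measurable_norm2exp c : measurable_fun setT
  (fun s : lowS R => (S_norm s ^+ 2 * expR (- (c * S_norm s)))%:E).
Proof.
have mN := @measurable_S_norm R.
apply/measurable_EFinP; apply: measurable_funM; first exact: measurable_funX.
apply: (measurableT_comp (@measurable_expR R)).
apply: (measurableT_comp (@oppr_measurable R setT)).
exact: measurable_funM.
Qed.

(** In coordinates the integrand is |x|^(-2) e^(-c|x|), which [radial_le_sqrtker] bounds by a
    product of four integrable functions. *)
Lemma integral_nu_norm2exp c : 0 < c ->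
  (\int[@nuS R]_s (S_norm s ^+ 2 * expR (- (c * S_norm s)))%:E < +oo)%E.
Proof.
move=> c0.
have N0 s : 0 <= S_norm s ^+ 2 * expR (- (c * S_norm s)).
  by rewrite mulr_ge0 ?expR_ge0 ?exprn_ge0 ?(ltW (S_norm_gt0 _)).
have md := @measurable_nu_density R.
have d0 s : (0 <= (S_norm s ^- 4)%:E :> \bar R)%E.
  by rewrite lee_fin invr_ge0 exprn_ge0// ltW// S_norm_gt0.
rewrite ge0_integral_nu//; last exact: measurable_norm2exp.
rewrite ge0_integral_ds//; last 2 first.
- by apply: emeasurable_funM => //; exact: measurable_norm2exp.
- by move=> s; apply: mule_ge0; [rewrite lee_fin|exact: d0].
pose K := (2 * (1 + (c / 4)^-1)) ^+ 4.
pose k2 (x : measurableTypeR R * measurableTypeR R) :=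
  (sqrtkere x.1 * sqrtkere x.2)%E.
have mk2 : measurable_fun setT k2.
  by apply: emeasurable_funM; apply: measurableT_comp => //;
    exact: measurable_sqrtkere.
have kg0 (x : R) : (0 <= sqrtkere x)%E by rewrite ltW// sqrtkere_gt0.
have k20 x : (0 <= k2 x)%E by rewrite mule_ge0.
have K0 : 0 < K by rewrite exprn_gt0// mulr_gt0// addr_gt0// invr_gt0 divr_gt0.
have k2int : (\int[@lebesgue2 R]_x k2 x <= 16%:E)%E.
  rewrite /lebesgue2 (ge0_integral_prod lebesgue_measure lebesgue_measure)//.
  - have -> : 16%:E = (4%:E * 4%:E)%E :> \bar R
    by rewrite -EFinM; congr EFin; ring.
    by apply: lee_pmul; rewrite ?integral_ge0//; exact: integral_sqrtkere.
  - exact: measurable_sqrtkere.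
  - exact: measurable_sqrtkere.
apply: (@le_lt_trans _ _ (\int[@lebesgue4 R]_x (K%:E * (k2 x.1 * k2 x.2)))%E).
  apply: ge0_le_integral => //.
  - by move=> x _; rewrite !mule_ge0// lee_fin.
  - apply: emeasurable_funM.
      apply: (measurableT_comp (f := fun s =>
        ((S_norm s ^+ 2 * expR (- (c * S_norm s)))%:E *
         (S_norm s ^- 4)%:E)%E)).
        by apply: emeasurable_funM => //; exact: measurable_norm2exp.
      exact: measurable_S_of_coord.
    by apply/measurable_EFinP; apply: measurable_indic;
      exact: (@measurable_S_domain R).
  - apply: measurable_funeM; apply: emeasurable_funM.
      exact: (measurableT_comp mk2 measurable_fst).
    exact: (measurableT_comp mk2 measurable_snd).
  move=> x _; rewrite indicE.
  have [Dx|nDx] := pselect (S_domain x); last first.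
    by rewrite memNset// mule0 !mule_ge0// lee_fin ltW.
  rewrite mem_set// mule1 -EFinM.
  have [a0 b0] := Dx.
  rewrite /k2.
  (* On [S_domain] only the off-diagonal coordinates can vanish, and there the majorant is +oo. *)
  have [p0|p0] := eqVneq x.2.1 0.
    rewrite {3}/sqrtkere p0 eqxx gt0_mulye ?sqrtkere_gt0//
      gt0_muley ?mule_gt0 ?sqrtkere_gt0//.
    by rewrite gt0_muley ?leey ?lte_fin.
  have [q0|q0] := eqVneq x.2.2 0.
    rewrite {4}/sqrtkere q0 eqxx gt0_muley ?sqrtkere_gt0//
      gt0_muley ?mule_gt0 ?sqrtkere_gt0//.
    by rewrite gt0_muley ?leey ?lte_fin.
  rewrite /sqrtkere (negbTE p0) (negbTE q0) !gt_eqF// -!EFinM lee_fin.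
  apply: le_trans (radial_le_sqrtker c0 (lt0r_neq0 a0) (lt0r_neq0 b0) p0 q0
    erefl).
  rewrite S_normE S_of_coordK// -/(sq4 x) -/(norm4 x) -norm4_sq.
  rewrite le_eqVlt; apply/orP; left; apply/eqP.
  rewrite mulrAC; congr (_ * _).
  have : norm4 x != 0 by rewrite -(S_of_coordK Dx) -S_normE gt_eqF// S_norm_gt0.
  by move=> n0; field.
rewrite ge0_integralZl//; last 3 first.
- apply: emeasurable_funM.
    exact: (measurableT_comp mk2 measurable_fst).
  exact: (measurableT_comp mk2 measurable_snd).
- by move=> x _; rewrite mule_ge0.
- by rewrite lee_fin ltW.
rewrite /lebesgue4 (ge0_integral_prod lebesgue2 lebesgue2)//.
rewrite (@le_lt_trans _ _ (K%:E * (16%:E * 16%:E))%E)//.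
  apply: lee_wpmul2l; first by rewrite lee_fin ltW.
  by apply: lee_pmul; rewrite ?integral_ge0.
by rewrite -!EFinM ltry.
Qed.

End dilation.

(** * Characters of N *)

Section normc_lemmas.
Variable R : realType.
Implicit Types z w : R[i].

Lemma normc_sq z : normc z ^+ 2 = complex.Re z ^+ 2 + complex.Im z ^+ 2.
Proof. by case: z => a b; rewrite /= sqr_sqrtr// addr_ge0 ?sqr_ge0. Qed.

Lemma normc_nneg z : 0 <= normc z.
Proof. by case: z => a b; exact: sqrtr_ge0. Qed.

Lemma normcD_le z w : normc (z + w) <= normc z + normc w.
Proof. exact: le_normcD. Qed.

Lemma normc_opp z : normc (- z) = normc z.
Proof. exact: normcN. Qed.

Lemma normcD_sq z w : normc (z + w) ^+ 2 <= 2 * normc z ^+ 2 + 2 * normc w ^+ 2.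
Proof.
have h : normc (z + w) ^+ 2 <= (normc z + normc w) ^+ 2.
  by rewrite ler_pXn2r ?nnegrE ?addr_ge0 ?normc_nneg// normcD_le.
by have := sqr_ge0 (normc z - normc w); lra.
Qed.

Lemma normc_subC z w : normc (z - w) = normc (w - z).
Proof. by rewrite -opprB normc_opp. Qed.

Lemma normc_real (x : R) : normc x%:C = `|x|.
Proof. by rewrite /= expr0n addr0 sqrtr_sqr. Qed.

Lemma normc_conj z : normc z^* = normc z.
Proof. by case: z => a b; rewrite /= sqrrN. Qed.

Lemma normc_double z : normc (z + z) = 2 * normc z.
Proof.
case: z => a b /=; rewrite -[in RHS](@ger0_norm R 2)//
  -sqrtr_sqr -sqrtrM ?sqr_ge0//.
by congr Num.sqrt; ring.
Qed.

(** Factor z^2 - 1 as (z - 1)(z + 1); the parallelogram law gives |z + 1|^2 = 4 - |z - 1|^2 >= 3. *)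
Lemma normc_sqr_sub1 z : normc z = 1 -> normc (z - 1) <= 1 ->
  3 * normc (z - 1) ^+ 2 <= normc (z * z - 1) ^+ 2.
Proof.
move=> z1 zs.
have -> : z * z - 1 = (z - 1) * (z + 1) by ring.
rewrite normcM exprMn mulrC ler_wpM2l ?sqr_ge0//.
have h1 : normc (z - 1) ^+ 2 <= 1 by rewrite expr_le1// normc_nneg.
have : normc (z - 1) ^+ 2 + normc (z + 1) ^+ 2 = 2 * normc z ^+ 2 + 2.
  by rewrite !normc_sq; case: z {z1 zs h1} => a b /=; ring.
rewrite z1; move: h1; lra.
Qed.

Lemma normcB1_le2 z : normc z = 1 -> normc (z - 1) ^+ 2 <= 4.
Proof.
move=> z1; have : normc (z - 1) ^+ 2 + normc (z + 1) ^+ 2 =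
  2 * normc z ^+ 2 + 2.
  by rewrite !normc_sq; case: z {z1} => a b /=; ring.
by rewrite z1; have := sqr_ge0 (normc (z + 1)); lra.
Qed.

(** The entrywise l^1 norm: real-valued, submultiplicative for rectangular products, invariant under
    conjugate transposition and additive over blocks. *)
Definition mnorm m n (A : 'M[R[i]]_(m, n)) : R := \sum_i \sum_j normc (A i j).

Lemma mnorm_ge0 m n (A : 'M[R[i]]_(m, n)) : 0 <= mnorm A.
Proof. by rewrite sumr_ge0// => i _; rewrite sumr_ge0// => j _;
  exact: normc_nneg. Qed.

Lemma mnorm_entry m n (A : 'M[R[i]]_(m, n)) i j : normc (A i j) <= mnorm A.
Proof.
rewrite /mnorm (bigD1 i)//= (bigD1 j)//= -addrA lerDl addr_ge0// sumr_ge0//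
  => k _.
  exact: normc_nneg.
by rewrite sumr_ge0// => l _; exact: normc_nneg.
Qed.

Lemma mnormD m n (A B : 'M[R[i]]_(m, n)) : mnorm (A + B) <= mnorm A + mnorm B.
Proof.
rewrite /mnorm -big_split; apply: ler_sum => i _.
rewrite -big_split; apply: ler_sum => j _.
by rewrite mxE; exact: normcD_le.
Qed.

Lemma mnorm_double m n (A : 'M[R[i]]_(m, n)) : mnorm (A + A) = 2 * mnorm A.
Proof.
rewrite /mnorm mulr_sumr; apply: eq_bigr => i _; rewrite mulr_sumr.
by apply: eq_bigr => j _; rewrite mxE normc_double.
Qed.

Lemma normc_sum I (r : seq I) (P : pred I) (F : I -> R[i]) :
  normc (\sum_(i <- r | P i) F i) <= \sum_(i <- r | P i) normc (F i).
Proof.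
elim/big_rec2: _ => [|i x y _ h]; first by rewrite normc0.
by apply: le_trans (normcD_le _ _) _; rewrite lerD2l.
Qed.

Lemma mnormM m n p (A : 'M[R[i]]_(m, n)) (B : 'M[R[i]]_(n, p)) :
  mnorm (A *m B) <= mnorm A * mnorm B.
Proof.
rewrite /mnorm mulr_suml; apply: ler_sum => i _.
apply: (@le_trans _ _ (\sum_j \sum_k normc (A i k) * normc (B k j))).
  apply: ler_sum => j _; rewrite mxE; apply: le_trans (normc_sum _ _ _) _.
  by apply: ler_sum => k _; rewrite normcM.
rewrite exchange_big /= mulr_suml; apply: ler_sum => k _.
rewrite -mulr_sumr ler_wpM2l ?normc_nneg//.
rewrite (bigD1 k)//= lerDl sumr_ge0// => l _.
by rewrite sumr_ge0// => j _; exact: normc_nneg.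
Qed.

Lemma mnorm_tC m n (A : 'M[R[i]]_(m, n)) : mnorm (A ^t*) = mnorm A.
Proof.
rewrite /mnorm exchange_big; apply: eq_bigr => i _; apply: eq_bigr => j _.
by rewrite !mxE normc_conj.
Qed.

Lemma mnorm_eq0 m n (A : 'M[R[i]]_(m, n)) : mnorm A = 0 -> A = 0.
Proof.
move=> A0; apply/matrixP => i j; rewrite mxE; apply: eq0_normc.
by apply/eqP; rewrite eq_le normc_nneg andbT -A0 mnorm_entry.
Qed.

Lemma mnorm_lowS (s : lowS R) : mnorm s <= 4 * S_norm s.
Proof.
have e1 : lift ord0 ord0 = 1 :> 'I_2 by apply: val_inj.
have [s0 s1] := S_coord_real s; have /and3P[/eqP s01 _ _] := smxP s.
have N2 : S_norm s ^+ 2 = sq4 (S_coord s) by rewrite S_normE norm4_sq.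
have le (z : R[i]) : normc z ^+ 2 <= sq4 (S_coord s) -> normc z <= S_norm s.
  by rewrite -N2 ler_pXn2r ?nnegrE ?normc_nneg ?(ltW (S_norm_gt0 _)).
rewrite /mnorm !big_ord_recl !big_ord0 /= !e1 s01 normc0.
have h0 : normc (s 0 0) <= S_norm s.
  apply: le; rewrite s0 normc_sq /sq4 /= expr0n addr0 -addrA lerDl.
  by rewrite !addr_ge0 ?sqr_ge0.
have h1 : normc (s 1 1) <= S_norm s.
  apply: le; rewrite s1 normc_sq /sq4 /= expr0n addr0 (addrC (_ ^+ 2)) -addrA
    lerDl.
  by rewrite !addr_ge0 ?sqr_ge0.
have h2 : normc (s 1 0) <= S_norm s.
  by apply: le; rewrite normc_sq /sq4 /= lerDr !addr_ge0 ?sqr_ge0.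
have := S_norm_gt0 s; lra.
Qed.

End normc_lemmas.

Section character.
Variable R : realType.
Variables (chi : 'M[R[i]]_2 -> R[i]).
Hypothesis chiP : unitary_character chi.

Lemma skewN0 : skewN (0 : 'M[R[i]]_2).
Proof. by rewrite /skewN /= trmx0 map_mx0 addr0. Qed.

Lemma skewND (m n : 'M[R[i]]_2) : skewN m -> skewN n -> skewN (m + n).
Proof.
by rewrite /skewN /= => h1 h2; rewrite linearD /= map_mxD addrACA h1 h2 addr0.
Qed.

Lemma skewNN (m : 'M[R[i]]_2) : skewN m -> skewN (- m).
Proof.
by rewrite /skewN /= => h1; rewrite linearN /= map_mxN -opprD h1 oppr0.
Qed.

Lemma char_norm m : skewN m -> normc (chi m) = 1.
Proof. by have [h _ _] := chiP; move=> /h; case. Qed.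

Lemma charD m n : skewN m -> skewN n -> chi (m + n) = chi m * chi n.
Proof. by have [_ h _] := chiP; exact: h. Qed.

Lemma char_neq0 m : skewN m -> chi m != 0.
Proof.
move=> /char_norm h; apply/eqP => h0; move: h; rewrite h0 normc0 => /eqP.
by rewrite eq_sym oner_eq0.
Qed.

Lemma char0 : chi 0 = 1.
Proof.
apply: (mulfI (char_neq0 skewN0)).
by rewrite -charD ?addr0 ?mulr1//; exact: skewN0.
Qed.

Lemma char_sub m n : skewN m -> skewN n ->
  normc (chi m - chi n) = normc (chi (m - n) - 1).
Proof.
move=> mN nN; rewrite -[in LHS](subrK n m) (charD (skewND mN (skewNN nN)) nN).
by rewrite -[X in _ - X]mul1r -mulrBl normcM char_norm// mulr1.
Qed.

Lemma char_near0 : exists2 d : R, 0 < d &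
  forall m, skewN m -> mnorm m < d -> normc (chi m - 1) <= 1.
Proof.
have [_ _ /subspace_continuousP chic] := chiP.
have h : nbhs (chi 0) [set z | normc (z - 1) <= 1].
  apply/nbhs_ballP; exists 1 => //= z.
  by rewrite /ball /= char0 distrC ltcR => /ltW.
have := chic 0 skewN0 _ h.
rewrite /fmap /= => /nbhs_ballP [e /= e0 eb].
(* Radii of balls of complex matrices are positive elements of [R[i]], hence real. *)
have eE : e = (complex.Re e)%:C.
  by move: e0; rewrite ltcE; case: (e) => a b /= /andP[/eqP -> _].
exists (complex.Re e); first by move: e0; rewrite ltcE => /andP[].
move=> m mN me; apply: eb => //; split=> // i j; rewrite mxE.
by rewrite /ball /= sub0r normrN eE ltcR;
  exact: le_lt_trans (mnorm_entry _ _ _) me.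
Qed.

(* chi need not be identified with an exponential: when |chi m - 1| <= 1,
   doubling m multiplies |chi m - 1|^2 by at least 3 > 2, so this square decays
   at least linearly. *)
Lemma char_hoelder : exists2 K : R, 0 <= K &
  forall m, skewN m -> normc (chi m - 1) ^+ 2 <= K * mnorm m.
Proof.
have [d d0 hd] := char_near0.
(* For [mnorm m] at least d the trivial bound |chi m - 1|^2 <= 4 suffices; the induction below is on
   a number of doublings after which m reaches that size. *)
exists (4 / d); first by rewrite divr_ge0// ltW.
have base m : skewN m -> d <= mnorm m -> normc (chi m - 1) ^+ 2 <=
  4 / d * mnorm m.
  move=> mN dm; apply: (le_trans (normcB1_le2 (char_norm mN))).
  by rewrite -mulrA ler_peMr// mulrC ler_pdivlMr// mul1r.
have ind k : forall m, skewN m -> d <= 2 ^+ k * mnorm m ->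
    normc (chi m - 1) ^+ 2 <= 4 / d * mnorm m.
  elim: k => [|k IH] m mN; first by rewrite mul1r; exact: base.
  move=> dm; have [md|/hd md] := leP d (mnorm m); first exact: base.
  have h1 := normc_sqr_sub1 (char_norm mN) (md mN).
  have := IH (m + m) (skewND mN mN).
  rewrite mnorm_double mulrA -exprSr charD// => /(_ dm) h2.
  have : 0 <= 4 / d * mnorm m by rewrite mulr_ge0 ?mnorm_ge0// divr_ge0// ltW.
  by move: h1 h2; rewrite (mulrCA _ 2); set x := normc _ ^+ 2; lra.
move=> m mN; have [m0|m0] := eqVneq (mnorm m) 0.
  by rewrite (mnorm_eq0 m0) char0 subrr normc0 expr0n mulr_ge0 ?mnorm_ge0//
    divr_ge0// ltW.
have mp : 0 < mnorm m by rewrite lt0r m0 mnorm_ge0.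
have [k kd] : exists k, d / mnorm m <= 2 ^+ k.
  exists (Num.bound (d / mnorm m)).
  apply: le_trans (ltW (archi_boundP _)) _; first by rewrite divr_ge0// ltW.
  by rewrite -natrX ler_nat ltnW// ltn_expl.
by apply: (ind k) => //; rewrite -ler_pdivrMr.
Qed.

End character.

(** * Measurability of complex functions and of characters *)

Section measurable_complex.
Context d (X : measurableType d) (R : realType).
Implicit Types F G : X -> R[i].

Lemma measurable_complexD F G : measurable_complex F -> measurable_complex G ->
  measurable_complex (fun x => F x + G x).
Proof.
move=> [F1 F2] [G1 G2]; split.
  rewrite (_ : (fun _ => _) = (fun x => complex.Re (F x) + complex.Re (G x))).
    exact: measurable_funD.
  by apply/funext => x; case: (F x) (G x) => a b [].
rewrite (_ : (fun _ => _) = (fun x => complex.Im (F x) + complex.Im (G x))).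
  exact: measurable_funD.
by apply/funext => x; case: (F x) (G x) => a b [].
Qed.

Lemma measurable_complexM F G : measurable_complex F -> measurable_complex G ->
  measurable_complex (fun x => F x * G x).
Proof.
move=> [F1 F2] [G1 G2]; split.
  rewrite (_ : (fun _ => _) = (fun x => complex.Re (F x) * complex.Re (G x) -
      complex.Im (F x) * complex.Im (G x))).
    by apply: measurable_funB; exact: measurable_funM.
  by apply/funext => x; case: (F x) (G x) => a b [].
rewrite (_ : (fun _ => _) = (fun x => complex.Re (F x) * complex.Im (G x) +
    complex.Im (F x) * complex.Re (G x))).
  by apply: measurable_funD; exact: measurable_funM.
by apply/funext => x; case: (F x) (G x) => a b [].
Qed.

Lemma measurable_complexN F : measurable_complex F ->
  measurable_complex (fun x => - F x).
Proof.
move=> [F1 F2]; split.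
  rewrite (_ : (fun _ => _) = (fun x => - complex.Re (F x))).
    exact: (measurableT_comp (@oppr_measurable R setT)).
  by apply/funext => x; case: (F x).
rewrite (_ : (fun _ => _) = (fun x => - complex.Im (F x))).
  exact: (measurableT_comp (@oppr_measurable R setT)).
by apply/funext => x; case: (F x).
Qed.

Lemma measurable_complex_conj F : measurable_complex F ->
  measurable_complex (fun x => (F x)^*).
Proof.
move=> [F1 F2]; split.
  rewrite (_ : (fun _ => _) = (fun x => complex.Re (F x)))//.
  by apply/funext => x; case: (F x).
rewrite (_ : (fun _ => _) = (fun x => - complex.Im (F x))).
  exact: (measurableT_comp (@oppr_measurable R setT)).
by apply/funext => x; case: (F x).
Qed.

Lemma measurable_complex_cst (z : R[i]) : measurable_complex (fun _ : X => z).
Proof. by split; exact: measurable_cst. Qed.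

Lemma measurable_complex_real (f : X -> R) : measurable_fun setT f ->
  measurable_complex (fun x => (f x)%:C).
Proof. by move=> mf; split=> //; exact: measurable_cst. Qed.

Lemma measurable_complex_sum I (r : seq I) (F : I -> X -> R[i]) :
  (forall i, measurable_complex (F i)) ->
  measurable_complex (fun x => \sum_(i <- r) F i x).
Proof.
move=> mF; elim: r => [|i r IH].
  by under eq_fun do rewrite big_nil; exact: measurable_complex_cst.
by under eq_fun do rewrite big_cons; exact: measurable_complexD.
Qed.

Lemma measurable_complex_mulmx m n p (A : X -> 'M[R[i]]_(m, n))
    (B : X -> 'M[R[i]]_(n, p)) :
  (forall i j, measurable_complex (fun x => A x i j)) ->
  (forall i j, measurable_complex (fun x => B x i j)) ->
  forall i j, measurable_complex (fun x => (A x *m B x) i j).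
Proof.
move=> mA mB i j; under eq_fun do rewrite mxE.
by apply: measurable_complex_sum => k; exact: measurable_complexM.
Qed.

Lemma measurable_normc2 F : measurable_complex F ->
  measurable_fun setT (fun x => normc (F x) ^+ 2).
Proof.
move=> [F1 F2]; under eq_fun do rewrite normc_sq.
by apply: measurable_funD; exact: measurable_funX.
Qed.

End measurable_complex.

Lemma measurable_complex_comp d d' (X : measurableType d)
    (Y : measurableType d') (R : realType) (F : Y -> R[i]) (h : X -> Y) :
  measurable_complex F -> measurable_fun setT h ->
  measurable_complex (fun x => F (h x)).
Proof. by move=> [F1 F2] mh; split;
  [exact: (measurableT_comp F1)|exact: (measurableT_comp F2)]. Qed.

Lemma ord2E (k : 'I_2) : k = 0 \/ k = 1.
Proof. by case: k => [[|[|[]]] // kl]; [left|right]; apply: val_inj. Qed.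

Section measurable_char.
Variable R : realType.
Local Notation mR := (measurableTypeR R).

Lemma measurable_S_entry (i j : 'I_2) :
  measurable_complex (fun s : lowS R => (s : 'M[R[i]]_2) i j).
Proof.
have mc := @measurable_S_coord R.
have m11 : measurable_fun setT (fun s : lowS R => (S_coord s).1.1 : R).
  exact: (measurableT_comp measurable_fst (measurableT_comp measurable_fst mc)).
have m12 : measurable_fun setT (fun s : lowS R => (S_coord s).1.2 : R).
  exact: (measurableT_comp measurable_snd (measurableT_comp measurable_fst mc)).
have m21 : measurable_fun setT (fun s : lowS R => (S_coord s).2.1 : R).
  exact: (measurableT_comp measurable_fst (measurableT_comp measurable_snd mc)).
have m22 : measurable_fun setT (fun s : lowS R => (S_coord s).2.2 : R).
  exact: (measurableT_comp measurable_snd (measurableT_comp measurable_snd mc)).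
case: (ord2E i) => ->; case: (ord2E j) => ->.
- rewrite (_ : (fun _ => _) = fun s : lowS R => ((S_coord s).1.1)%:C);
  last first.
    by apply/funext => s; have [] := S_coord_real s.
  exact: measurable_complex_real.
- rewrite (_ : (fun _ => _) = fun s : lowS R => 0); last first.
    by apply/funext => s; have /and3P[/eqP ->] := smxP s.
  exact: measurable_complex_cst.
- by split.
- rewrite (_ : (fun _ => _) = fun s : lowS R => ((S_coord s).1.2)%:C);
  last first.
    by apply/funext => s; have [] := S_coord_real s.
  exact: measurable_complex_real.
Qed.

Variables (chi : 'M[R[i]]_2 -> R[i]).
Hypothesis chiP : unitary_character chi.

Lemma skewNP (B : 'M[R[i]]_2) : skewN B <-> forall i j, B i j + (B j i)^* = 0.
Proof.
rewrite /skewN /=; split=> [/matrixP h i j|h]; first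
  by have := h i j; rewrite !mxE.
by apply/matrixP => i j; rewrite !mxE.
Qed.

Lemma skewNZ (x : R) (B : 'M[R[i]]_2) : skewN B -> skewN (x%:C *: B).
Proof.
move=> /skewNP BN; apply/skewNP => i j; rewrite !mxE.
have <- : x%:C * (B i j + (B j i)^*) = x%:C * B i j + (x%:C * B j i)^*.
  case: (B i j) (B j i) => a b [c e] /=; apply/eqP.
  by rewrite eq_complex /=; apply/andP; split; apply/eqP; ring.
by rewrite BN mulr0.
Qed.

(** [char_hoelder], applied to (x - y) B, makes the function continuous in x, and continuity on the
    line gives measurability. *)
Lemma measurable_char_line (B : 'M[R[i]]_2) : skewN B ->
  measurable_complex (fun x : mR => chi ((x : R)%:C *: B)).
Proof.
move=> BN; have [K K0 hK] := char_hoelder chiP.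
have est (x y : R) : normc (chi (x%:C *: B) - chi (y%:C *: B)) ^+ 2 <=
    K * mnorm B * `|x - y|.
  have xN := skewNZ x BN; have yN := skewNZ y BN.
  rewrite char_sub//; apply: (le_trans (hK _ (skewND xN (skewNN yN)))).
  rewrite -mulrA ler_wpM2l// -scalerBl -rmorphB /= /mnorm mulr_suml.
  apply: ler_sum => i _; rewrite mulr_suml; apply: ler_sum => j _.
  by rewrite mxE normcM normc_real mulrC.
have cont (p : R[i] -> R) : (forall z w, `|p z - p w| <= normc (z - w)) ->
    continuous (fun x : R => p (chi (x%:C *: B))).
  move=> hp x; apply/cvgrPdist_lt => e e0.
  near=> y; rewrite -(@ltr_pXn2r _ 2) ?nnegrE ?(ltW e0)//.
  (* Adding 1 makes the constant positive, so that it can be divided by. *)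
  apply: (@le_lt_trans _ _ ((K * mnorm B + 1) * `|x - y|)).
    apply: (@le_trans _ _ (normc (chi (x%:C *: B) - chi (y%:C *: B)) ^+ 2)).
      by rewrite ler_pXn2r ?nnegrE ?normc_nneg//.
    by apply: (le_trans (est _ _)); rewrite ler_wpM2r// lerDl.
  rewrite -ltr_pdivlMl ?ltr_wpDl ?mulr_ge0 ?mnorm_ge0//.
  near: y; apply: (@cvgr_dist_lt _ _ _ (nbhs x) _ id) => //.
  by rewrite mulr_gt0 ?invr_gt0 ?ltr_wpDl ?mulr_ge0 ?mnorm_ge0// exprn_gt0.
have pn (a b : R) (z : R[i]) :
    a ^+ 2 + b ^+ 2 = normc z ^+ 2 -> `|a| <= normc z.
  move=> h; rewrite -(@ler_pXn2r _ 2) ?nnegrE ?normc_nneg// -h.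
  by rewrite real_normK ?num_real// lerDl sqr_ge0.
split; apply: continuous_measurable_fun; apply: (cont).
  move=> [a b] [c e] /=; apply: (pn _ (b - e) ((a - c) +i* (b - e))).
  by rewrite normc_sq.
move=> [a b] [c e] /=; apply: (pn _ (a - c) ((a - c) +i* (b - e))).
by rewrite normc_sq addrC.
Unshelve. all: by end_near.
Qed.

Lemma measurable_char d (X : measurableType d) (A : X -> 'M[R[i]]_2) :
  (forall x, skewN (A x)) ->
  (forall i j, measurable_complex (fun x => A x i j)) ->
  measurable_complex (fun x => chi (A x)).
Proof.
move=> AN mA.
(* The coordinates of skewN, so that chi is a product of functions of one real
   variable. *)
pose B (a b c e : R) : 'M[R[i]]_2 := \matrix_(k, l)
  if k == 0 then (if l == 0 then 0 +i* a else (- c) +i* e)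
  else (if l == 0 then c +i* e else 0 +i* b).
have BN a b c e : skewN (B a b c e).
  apply/skewNP => k l; case: (ord2E k) => ->; case: (ord2E l) => ->;
    rewrite !mxE /=; apply/eqP;
      rewrite eq_complex /= ?addr0 ?oppr0 ?subrr ?eqxx//.
  - by rewrite addNr eqxx.
pose B1 := B 1 0 0 0; pose B2 := B 0 1 0 0.
pose B3 := B 0 0 1 0; pose B4 := B 0 0 0 1.
have B1N : skewN B1 by exact: BN.
have B2N : skewN B2 by exact: BN.
have B3N : skewN B3 by exact: BN.
have B4N : skewN B4 by exact: BN.
have BD a b c e : a%:C *: B1 + b%:C *: B2 + (c%:C *: B3 + e%:C *: B4) =
  B a b c e.
  apply/matrixP => k l; rewrite !mxE.
  case: (ord2E k) => ->; case: (ord2E l) => -> /=; apply/eqP;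
    rewrite eq_complex /=; apply/andP; split; apply/eqP; ring.
have AE x : A x =
  (complex.Im (A x 0 0))%:C *: B1 + (complex.Im (A x 1 1))%:C *: B2 +
  ((complex.Re (A x 1 0))%:C *: B3 + (complex.Im (A x 1 0))%:C *: B4).
  rewrite BD; have /skewNP AN' := AN x.
  have h00 := AN' 0 0; have h11 := AN' 1 1; have h01 := AN' 0 1.
  have re0 (z : R[i]) : z + z^* = 0 -> z = 0 +i* complex.Im z.
    case: z => u v /= /eqP; rewrite eq_complex /= => /andP[/eqP u0 _].
    by congr (_ +i* _); lra.
  apply/matrixP => k l; rewrite [RHS]mxE.
  case: (ord2E k) => ->; case: (ord2E l) => -> /=.
  - exact: re0.
  - move: h01; case: (A x 0 1) (A x 1 0) => u v [u' v'] /= /eqP.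
    rewrite eq_complex /= => /andP[/eqP h1 /eqP h2].
    by congr (_ +i* _); lra.
  - by case: (A x 1 0).
  - exact: re0.
have BE x : chi (A x) = chi ((complex.Im (A x 0 0))%:C *: B1) *
   chi ((complex.Im (A x 1 1))%:C *: B2) *
  (chi ((complex.Re (A x 1 0))%:C *: B3) *
   chi ((complex.Im (A x 1 0))%:C *: B4)).
  by rewrite {1}AE !(charD chiP)//; do ?[exact: skewNZ | apply: skewND].
rewrite (funext BE).
have [_ m00] := mA 0 0; have [_ m11] := mA 1 1; have [m10 m10'] := mA 1 0.
apply: measurable_complexM; apply: measurable_complexM;
  exact: (measurable_complex_comp (measurable_char_line _)).
Qed.

End measurable_char.

(** * The representation *)

Section L2_energy.
Context d (X : measurableType d) (R : realType).
Variable mu : {measure set X -> \bar R}.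
Implicit Types F G : X -> R[i].

(** The square of [L2norm]. Estimates are made on it, where integrals can be compared and added, and
    [L2norm_le] and [L2norm_le_fin] return to norms. *)
Definition energy F : \bar R := (\int[mu]_x (normc (F x) ^+ 2)%:E)%E.

Lemma energy_ge0 F : (0 <= energy F)%E.
Proof. by apply: integral_ge0 => x _; rewrite lee_fin sqr_ge0. Qed.

Lemma L2normE F : L2norm mu F = (energy F `^ 2^-1)%E.
Proof.
rewrite /L2norm unlock /energy; congr (_ `^ _)%E; apply: eq_integral => x _.
by rewrite abse_EFin ger0_norm ?normc_nneg// poweR_EFin powR_mulrn// normc_nneg.
Qed.

Lemma L2P F : L2 mu F <-> measurable_complex F /\ (energy F < +oo)%E.
Proof.
rewrite /L2 /= L2normE; split=> -[mF h]; split=> //; last exact: poweR_lty.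
by apply: lty_poweRy h; rewrite invr_neq0.
Qed.

Lemma L2norm_le F G (k : R) : 0 <= k -> (energy F <= k%:E * energy G)%E ->
  (L2norm mu F <= (Num.sqrt k)%:E * L2norm mu G)%E.
Proof.
move=> k0 h; rewrite !L2normE.
have -> : (Num.sqrt k)%:E = (k%:E `^ 2^-1)%E by rewrite poweR_EFin powR12_sqrt.
rewrite -poweRM ?lee_fin ?energy_ge0//; apply: gt0_ler_poweR => //.
- by rewrite in_itv /= energy_ge0 leey.
- by rewrite in_itv /= mule_ge0 ?energy_ge0 ?lee_fin// leey.
Qed.

Lemma L2norm_le_fin F (k : R) : 0 <= k -> (energy F <= k%:E)%E ->
  (L2norm mu F <= (Num.sqrt k)%:E)%E.
Proof.
move=> k0 h; rewrite L2normE -(powR12_sqrt k0) -poweR_EFin.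
apply: gt0_ler_poweR => //.
- by rewrite in_itv /= energy_ge0 leey.
- by rewrite in_itv /= lee_fin k0 leey.
Qed.

End L2_energy.

Section representation.
Variable R : realType.
Variables (chi : 'M[R[i]]_2 -> R[i]).
Hypothesis chiP : unitary_character chi.

Lemma opT_NS (n : 'M[R[i]]_2) (t : lowS R) (F : lowS R -> R[i]) :
  opT chi (N_block n *m S_block t) F =
  (fun s => chi (s *m n *m s ^t*) * F (mulS s t)).
Proof. by have [h1 h2] := P_partE n t; apply/funext => s;
  rewrite /opT h1 h2. Qed.

Lemma opT1 (F : lowS R -> R[i]) : opT chi 1%:M F = F.
Proof.
have -> : 1%:M = N_block 0 *m S_block (oneS R)
  by rewrite N_block0 S_block1 mul1mx.
rewrite opT_NS; apply/funext => s.
by rewrite mulmx0 mul0mx (char0 chiP) mul1r mulS1.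
Qed.

(** The N-part of the product is n1 + t1 n2 t1^* , and conjugating it by s gives s n1 s^* + (s t1)
    n2 (s t1)^* , on which [chi] is multiplicative. The equality is pointwise, for any function, so
    it applies to [f_exp] outside L^2. *)
Lemma opTM (g1 g2 : 'M[R[i]]_(2 + 2)) (F : lowS R -> R[i]) :
  grpP g1 -> grpP g2 ->
  opT chi (g1 *m g2) F = opT chi g1 (opT chi g2 F).
Proof.
move=> /P_decomposition[n1 [t1 [n1N ->]]] /P_decomposition[n2 [t2 [n2N ->]]].
have -> : N_block n1 *m S_block t1 *m (N_block n2 *m S_block t2) =
    N_block (n1 + t1 *m n2 *m t1 ^t*) *m S_block (mulS t1 t2).
  by rewrite -N_blockD -S_blockM !mulmxA -[N_block n1 *m _ *m N_block n2]mulmxA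
    S_blockN !mulmxA.
rewrite !opT_NS; apply/funext => s.
have -> : s *m (n1 + t1 *m n2 *m t1 ^t*) *m s ^t* =
   s *m n1 *m s ^t* + mulS s t1 *m n2 *m (mulS s t1) ^t*.
  by rewrite mulmxDr mulmxDl /= trmx_mul map_mxM /= !mulmxA.
rewrite (charD chiP) ?mulrA ?mulSA//; exact: N_conj.
Qed.

Lemma measurable_opT (g : 'M[R[i]]_(2 + 2)) (F : lowS R -> R[i]) : grpP g ->
  measurable_complex F -> measurable_complex (opT chi g F).
Proof.
move=> /P_decomposition[n [t [nN ->]]] mF; rewrite opT_NS.
apply: measurable_complexM; last first.
  exact: (measurable_complex_comp mF (measurable_mulS t)).
apply: (measurable_char chiP) => [s|]; first exact: N_conj.
apply: measurable_complex_mulmx => [|i j].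
  apply: measurable_complex_mulmx => i j; first exact: measurable_S_entry.
  exact: measurable_complex_cst.
under eq_fun do rewrite !mxE.
by apply: measurable_complex_conj; exact: measurable_S_entry.
Qed.

Lemma energy_opT_NS (n : 'M[R[i]]_2) (t : lowS R) (F : lowS R -> R[i]) :
  skewN n ->
  energy (@nuS R) (opT chi (N_block n *m S_block t) F) =
  (\int[@nuS R]_s (normc (F (mulS s t)) ^+ 2)%:E)%E.
Proof.
move=> nN; apply: eq_integral => s _;
  rewrite opT_NS normcM (char_norm chiP) ?mul1r//.
exact: N_conj.
Qed.

Lemma energy_opT_le (g : 'M[R[i]]_(2 + 2)) : grpP g -> exists2 K : R, 0 <= K &
  forall F, measurable_complex F ->
    (energy (@nuS R) (opT chi g F) <= K%:E * energy (@nuS R) F)%E.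
Proof.
move=> /P_decomposition[n [t [nN ->]]].
have [K K0 hK] := ge0_integral_nu_mulS_le t.
exists K => // F mF; rewrite energy_opT_NS//.
apply: (hK (fun s => (normc (F s) ^+ 2)%:E)).
  by apply/measurable_EFinP; exact: measurable_normc2.
by move=> s; rewrite lee_fin sqr_ge0.
Qed.

Lemma opT_representation : L2_representation (@nuS R) (@grpP R) (opT chi).
Proof.
split.
- move=> g Gg F /L2P[mF eF]; apply/L2P; split; first exact: measurable_opT.
  have [K K0 hK] := energy_opT_le Gg; apply: le_lt_trans (hK _ mF) _.
  by rewrite lte_mul_pinfty ?lee_fin.
- move=> g Gg a F1 F2 _ _; apply: aeW => s.
  by rewrite /opT mulrDr mulrCA.
- move=> g Gg; have [K K0 hK] := energy_opT_le Gg.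
  exists (Num.sqrt K) => F /L2P[mF _]; apply: L2norm_le => //; exact: hK.
- by move=> F _; rewrite opT1; exact: aeW.
- by move=> g1 g2 G1 G2 F _; rewrite opTM//; exact: aeW.
Qed.

End representation.

(** * The cocycle *)

Section orbit_continuity.
Variable R : realType.
Variables (chi : 'M[R[i]]_2 -> R[i]).
Hypothesis chiP : unitary_character chi.
Local Notation f := (@f_exp R).

(** For x <= y the difference is e^(-x) (1 - e^(-(y - x))), and 1 - e^(-u) <= u. Retaining e^(-m)
    keeps the decay at infinity that square integrability requires. *)
Lemma expRN_dist (m x y : R) : m <= x -> m <= y ->
  `|expR (- x) - expR (- y)| <= `|x - y| * expR (- m).
Proof.
wlog xy : x y / x <= y.
  move=> h mx my; have [|/ltW] := leP x y; first by move=> /h; exact.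
  by move=> /h => /(_ my mx); rewrite distrC (distrC y).
move=> mx my.
rewrite distrC (distrC x) ler0_norm ?subr_le0 ?ler_expR ?lerN2//.
rewrite ger0_norm ?subr_ge0// opprB.
have -> : expR (- x) - expR (- y) = expR (- x) * (1 - expR (- (y - x))).
  by rewrite mulrBr mulr1 -expRD; congr (_ - expR _); ring.
rewrite mulrC ler_pM ?expR_ge0//.
- by rewrite subr_ge0 -expR0 ler_expR oppr_le0 subr_ge0.
- by have := expR_ge1Dx (- (y - x)); lra.
- by rewrite ler_expR lerN2.
Qed.

Lemma measurable_f_exp : measurable_complex f.
Proof.
apply: measurable_complex_real; apply: (measurableT_comp (@measurable_expR R)).
apply: measurable_funM; last exact: measurable_cst.
exact: (measurableT_comp (@oppr_measurable R setT) (@measurable_S_norm R)).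
Qed.

Lemma f_expE (s : lowS R) : f s = (expR (- (S_norm s / 2)))%:C.
Proof. by rewrite /f_exp mulNr. Qed.

(** Inserting a mixed term separates the change of the character, controlled by [char_hoelder], from
    the change of the exponential, controlled by [expRN_dist]. The rate [c] is a common lower bound
    for |s t| / |s| and |s t0| / |s|. *)
Lemma normc_opT_f_dist : exists2 K : R, 0 <= K &
  forall (n n0 : 'M[R[i]]_2) (t t0 : lowS R) (c : R), skewN n -> skewN n0 ->
  (forall s, c * S_norm s <= S_norm (mulS s t)) ->
  (forall s, c * S_norm s <= S_norm (mulS s t0)) -> forall s,
  normc (opT chi (N_block n *m S_block t) f s -
         opT chi (N_block n0 *m S_block t0) f s) ^+ 2 <=
  (K * mnorm (n - n0) + norm4 (sub4 (S_coord t) (S_coord t0)) ^+ 2) *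
  (S_norm s ^+ 2 * expR (- (c * S_norm s))).
Proof.
have [H H0 hH] := char_hoelder chiP.
(* A factor 2 comes from the square of a sum, and 16 from [mnorm_lowS] used for s and for its
   conjugate transpose. *)
exists (32 * H) => [|n n0 t t0 c nN n0N ct ct0 s]; first by rewrite mulr_ge0.
rewrite !opT_NS !f_expE.
set x := S_norm (mulS s t); set y := S_norm (mulS s t0).
set z := chi (s *m n *m s ^t*); set z0 := chi (s *m n0 *m s ^t*).
set D := norm4 _; set r := S_norm s.
have r0 : 0 < r by exact: S_norm_gt0.
have -> : z * (expR (- (x / 2)))%:C - z0 * (expR (- (y / 2)))%:C =
  (z - z0) * (expR (- (x / 2)))%:C + 
  z0 * (expR (- (x / 2)) - expR (- (y / 2)))%:C.
  by rewrite rmorphB mulrBl mulrBr addrA subrK.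
apply: (le_trans (normcD_sq _ _)).
have z01 : normc z0 = 1 by apply: (char_norm chiP); exact: N_conj.
rewrite !normcM z01 mul1r !normc_real (ger0_norm (expR_ge0 _)) exprMn.
have e2 (u : R) : expR (- (u / 2)) ^+ 2 = expR (- u).
  by rewrite expr2 -expRD; congr expR; field.
have h1 : normc (z - z0) ^+ 2 <= H * (16 * r ^+ 2 * mnorm (n - n0)).
  rewrite /z /z0 (char_sub chiP); [|exact: N_conj..].
  apply: (le_trans (hH _ _)).
    by apply: skewND; [|apply: skewNN]; exact: N_conj.
  rewrite ler_wpM2l// -mulmxBl -mulmxBr.
  apply: (le_trans (mnormM _ _)); rewrite mnorm_tC.
  apply: (le_trans (ler_wpM2r (mnorm_ge0 _) (mnormM _ _))).
  rewrite mulrAC (_ : 16 * r ^+ 2 = (4 * r) * (4 * r)); last by ring.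
  by apply: ler_wpM2r; rewrite ?mnorm_ge0// ler_pM ?mnorm_ge0 ?mnorm_lowS.
have h2 : `|expR (- (x / 2)) - expR (- (y / 2))| ^+ 2 <=
    (r * D / 2) ^+ 2 * expR (- (c * r)).
  rewrite -(e2 (c * r)) -exprMn ler_pXn2r ?nnegrE//; last first.
    by rewrite mulr_ge0 ?expR_ge0// divr_ge0// mulr_ge0 ?norm4_ge0// ltW.
  apply: le_trans (@expRN_dist (c * r / 2) _ _ _ _) _.
  - by rewrite ler_pM2r ?invr_gt0 ?ct.
  - by rewrite ler_pM2r ?invr_gt0 ?ct0.
  rewrite ler_wpM2r ?expR_ge0// -mulrBl normrM (ger0_norm (_ : 0 <= 2^-1))//.
  by rewrite ler_wpM2r// S_norm_mul_dist.
have h3 : expR (- (x / 2)) ^+ 2 <= expR (- (c * r))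
  by rewrite e2 ler_expR lerN2 ct.
have h4 := ler_pM (sqr_ge0 _) (sqr_ge0 _) h1 h3.
have h5 : 0 <= D ^+ 2 * (r ^+ 2 * expR (- (c * r))).
  by rewrite mulr_ge0 ?sqr_ge0// mulr_ge0 ?sqr_ge0 ?expR_ge0.
move: h4 h2 h5; set A := _ * expR (- (x / 2)) ^+ 2; set B := `|_| ^+ 2.
set E := expR (- (c * r)); set M := mnorm _; clear; lra.
Qed.

Lemma energy_opT_f_dist : exists2 K : R, 0 <= K &
  forall (n n0 : 'M[R[i]]_2) (t t0 : lowS R) (c : R), skewN n -> skewN n0 ->
  (forall s, c * S_norm s <= S_norm (mulS s t)) ->
  (forall s, c * S_norm s <= S_norm (mulS s t0)) ->
  (energy (@nuS R) (fun s => opT chi (N_block n *m S_block t) f s -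
         opT chi (N_block n0 *m S_block t0) f s)%R <=
  (K * mnorm (n - n0) + norm4 (sub4 (S_coord t) (S_coord t0)) ^+ 2)%:E *
  \int[@nuS R]_s (S_norm s ^+ 2 * expR (- (c * S_norm s)))%:E)%E.
Proof.
have [K K0 hK] := normc_opT_f_dist.
exists K => // n n0 t t0 c nN n0N ct ct0.
have G (m : 'M[R[i]]_2) (u : lowS R) : skewN m -> grpP (N_block m *m S_block u).
  by move=> mN; apply: P_mul; [exact: P_N|exact: P_S].
rewrite -ge0_integralZl//; last 3 first.
- exact: measurable_norm2exp.
- by move=> s _; rewrite lee_fin mulr_ge0 ?expR_ge0// exprn_ge0// ltW//
  S_norm_gt0.
- by rewrite lee_fin addr_ge0 ?sqr_ge0// mulr_ge0// mnorm_ge0.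
apply: ge0_le_integral => //.
- by move=> s _; rewrite lee_fin sqr_ge0.
- apply/measurable_EFinP; apply: measurable_normc2.
  apply: measurable_complexD;
    first exact: (measurable_opT chiP (G _ _ nN) measurable_f_exp).
  by apply: measurable_complexN;
    exact: (measurable_opT chiP (G _ _ n0N) measurable_f_exp).
- by apply: measurable_funeM; exact: measurable_norm2exp.
by move=> s _; rewrite -EFinM lee_fin hK.
Qed.

(** At t0 the rate 1 / |t0^(-1)| is available, and moving t0 to t costs at most |s| |t - t0|. Giving
    up half of the rate makes it uniform in a neighbourhood of t0. *)
Lemma S_norm_mul_ge_near (t t0 : lowS R) :
  norm4 (sub4 (S_coord t) (S_coord t0)) <= (2 * S_norm (Defs.invS t0))^-1 ->
  forall s, (2 * S_norm (Defs.invS t0))^-1 * S_norm s <= S_norm (mulS s t).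
Proof.
set v := S_norm (Defs.invS t0); set D := norm4 _ => hD s.
have h1 : v^-1 * S_norm s <= S_norm (mulS s t0) by rewrite mulrC S_norm_mul_ge.
have h2 : S_norm (mulS s t0) - S_norm (mulS s t) <= S_norm s * D.
  rewrite /D norm4_subC; apply: le_trans (S_norm_mul_dist _ _ _);
    exact: ler_norm.
have h3 := ler_wpM2l (ltW (S_norm_gt0 s)) hD.
move: h1 h2 h3; rewrite invfM; clearbody D v;
  move: (S_norm _) (S_norm _) (S_norm _) => x y z; clear; lra.
Qed.

Lemma opT_f_sub_L2 (g : 'M[R[i]]_(2 + 2)) : grpP g ->
  L2 (@nuS R) (fun s => opT chi g f s - f s).
Proof.
move=> Gg; apply/L2P; split.
  apply: measurable_complexD;
    first exact: (measurable_opT chiP Gg measurable_f_exp).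
  by apply: measurable_complexN; exact: measurable_f_exp.
move: Gg => /P_decomposition[n [t [nN ->]]].
have [K K0 hK] := energy_opT_f_dist.
(* The comparison is with the identity of P, for which T(g0) f = f and the rate is 1; the other rate
   belongs to t. *)
pose c := Num.min 1 (S_norm (Defs.invS t))^-1.
have c0 : 0 < c by rewrite lt_min ltr01 invr_gt0 S_norm_gt0.
have := hK n 0 t (oneS R) c nN (skewN0 R).
rewrite N_block0 S_block1 mul1mx (opT1 chiP) => h.
apply: le_lt_trans (h _ _) _ => [s|s|].
- apply: le_trans (S_norm_mul_ge _ _);
  rewrite mulrC ler_wpM2l ?(ltW (S_norm_gt0 _))//.
  by rewrite ge_min lexx orbT.
- by rewrite mulS1 ler_piMl ?(ltW (S_norm_gt0 _))// ge_min lexx.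
- apply: lte_mul_pinfty; last exact: integral_nu_norm2exp.
    by rewrite lee_fin addr_ge0 ?sqr_ge0// mulr_ge0// mnorm_ge0.
  by [].
Qed.

End orbit_continuity.

(** * Recovering the factors n and s continuously from g *)

Section blocks.
Variable R : realType.

Lemma mnorm_block m1 m2 n1 n2 (A : 'M[R[i]]_(m1 + m2, n1 + n2)) :
  mnorm A = mnorm (ulsubmx A) + mnorm (ursubmx A) +
    (mnorm (dlsubmx A) + mnorm (drsubmx A)).
Proof.
rewrite /mnorm big_split_ord /= -!big_split /=; congr (_ + _);
  apply: eq_bigr => i _; rewrite big_split_ord; congr (_ + _);
  by apply: eq_bigr => j _; rewrite !mxE.
Qed.

Lemma mnorm_dlsubmx m1 m2 n1 n2 (A : 'M[R[i]]_(m1 + m2, n1 + n2)) :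
  mnorm (dlsubmx A) <= mnorm A.
Proof.
have := (mnorm_ge0 (ulsubmx A), mnorm_ge0 (ursubmx A), mnorm_ge0 (drsubmx A)).
by rewrite (mnorm_block A) => -[[]]; lra.
Qed.

Lemma mnorm_drsubmx m1 m2 n1 n2 (A : 'M[R[i]]_(m1 + m2, n1 + n2)) :
  mnorm (drsubmx A) <= mnorm A.
Proof.
have := (mnorm_ge0 (ulsubmx A), mnorm_ge0 (ursubmx A), mnorm_ge0 (dlsubmx A)).
by rewrite (mnorm_block A) => -[[]]; lra.
Qed.

Lemma dlsubmxB m1 m2 n1 n2 (A B : 'M[R[i]]_(m1 + m2, n1 + n2)) :
  dlsubmx (A - B) = dlsubmx A - dlsubmx B.
Proof. by apply/matrixP => i j; rewrite !mxE. Qed.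

Lemma drsubmxB m1 m2 n1 n2 (A B : 'M[R[i]]_(m1 + m2, n1 + n2)) :
  drsubmx (A - B) = drsubmx A - drsubmx B.
Proof. by apply/matrixP => i j; rewrite !mxE. Qed.

Lemma mnorm_S_coord (t t0 : lowS R) :
  norm4 (sub4 (S_coord t) (S_coord t0)) <=
    mnorm ((t : 'M[R[i]]_2) - (t0 : 'M[R[i]]_2)).
Proof.
have e1 : lift ord0 ord0 = 1 :> 'I_2 by apply: val_inj.
rewrite -(@ler_pXn2r _ 2) ?nnegrE ?norm4_ge0 ?mnorm_ge0// norm4_sq.
rewrite /mnorm !big_ord_recl !big_ord0 /= !e1 !mxE.
have [t0r t1r] := S_coord_real t; have [u0r u1r] := S_coord_real t0.
rewrite t0r t1r u0r u1r -!rmorphB !normc_real.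
set p := normc (_ - _); set q := normc (_ - _).
have p0 : 0 <= p by exact: normc_nneg.
have q0 : 0 <= q by exact: normc_nneg.
have -> : sq4 (sub4 (S_coord t) (S_coord t0)) =
  `|(S_coord t).1.1 - (S_coord t0).1.1| ^+ 2 +
  `|(S_coord t).1.2 - (S_coord t0).1.2| ^+ 2 + q ^+ 2.
  rewrite !real_normK ?num_real// /q normc_sq /sq4 /sub4 /=.
  by case: (t 1 0) (t0 1 0) => a b [].
set x := `|_|; set y := `|_|.
have x0 : 0 <= x by exact: normr_ge0.
have y0 : 0 <= y by exact: normr_ge0.
have h1 := mulr_ge0 x0 p0; have h2 := mulr_ge0 x0 q0; have h3 := mulr_ge0 x0 y0.
have h4 := mulr_ge0 p0 q0; have h5 := mulr_ge0 p0 y0; have h6 := mulr_ge0 q0 y0.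
have h7 := sqr_ge0 p.
move: h1 h2 h3 h4 h5 h6 h7; clearbody x y p q; clear; lra.
Qed.

Lemma NS_dist (n n0 : 'M[R[i]]_2) (t t0 : lowS R) (e : R) :
  let g := N_block n *m S_block t in let g0 := N_block n0 *m S_block t0 in
  mnorm (g - g0) <= e ->
  norm4 (sub4 (S_coord t) (S_coord t0)) <= e /\
  mnorm (n - n0) <= e * (mnorm t0 + e + mnorm (dlsubmx g0)).
Proof.
move=> g g0 ge.
have e0 : 0 <= e by apply: le_trans ge; exact: mnorm_ge0.
have nE (m : 'M[R[i]]_2) (u : lowS R) : m =
  dlsubmx (N_block m *m S_block u) *m u ^t*.
  by rewrite NS_blockE block_mxKdl mulmxKV// unitmx_tC S_unitmx.
have tE (m : 'M[R[i]]_2) (u : lowS R) : u =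
  drsubmx (N_block m *m S_block u) :> 'M[R[i]]_2.
  by rewrite NS_blockE block_mxKdr.
have te : mnorm ((t : 'M[R[i]]_2) - (t0 : 'M[R[i]]_2)) <= e.
  have -> : (t : 'M[R[i]]_2) - (t0 : 'M[R[i]]_2) = drsubmx (g - g0).
    by rewrite drsubmxB -!tE.
  exact: le_trans (mnorm_drsubmx _) ge.
split; first exact: le_trans (mnorm_S_coord _ _) te.
have -> : n - n0 = dlsubmx (g - g0) *m t ^t* +
    dlsubmx g0 *m ((t : 'M[R[i]]_2) - (t0 : 'M[R[i]]_2)) ^t*.
  rewrite {1}(nE n t) {1}(nE n0 t0) -/g -/g0.
  by rewrite dlsubmxB mulmxBl linearB /= map_mxB mulmxBr addrA subrK.
apply: (le_trans (mnormD _ _)); rewrite mulrDr; apply: lerD.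
  apply: (le_trans (mnormM _ _)); rewrite mnorm_tC ler_pM ?mnorm_ge0//.
    exact: le_trans (mnorm_dlsubmx _) ge.
  rewrite -[X in mnorm X](subrK (t0 : 'M[R[i]]_2)) addrC.
  by apply: (le_trans (mnormD _ _)); rewrite lerD2l.
apply: (le_trans (mnormM _ _)); rewrite mulrC mnorm_tC.
by rewrite ler_wpM2r ?mnorm_ge0.
Qed.

Lemma mnorm_sub_cvg0 m n (A : 'M[R[i]]_(m, n)) :
  mnorm (B - A) @[B --> nbhs A] --> (0 : R).
Proof.
apply/cvgrPdist_lt => e e0.
(* Each of the m n entries contributes at most d; the successor makes the total strictly less than e
   and allows empty matrices. *)
pose d := e / (m * n).+1%:R.
have d0 : 0 < d by rewrite divr_gt0.
near=> B.
rewrite sub0r normrN ger0_norm ?mnorm_ge0//.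
have AB : ball A d%:C B.
  near: B; apply/nbhs_ballP; exists d%:C => //=; by rewrite ltcR.
apply: (@le_lt_trans _ _ ((m * n)%:R * d)).
  rewrite mulr_natl mulnC mulrnA /mnorm.
  apply: (@le_trans _ _ (\sum_(i < m) (d *+ n))); last
    by rewrite sumr_const card_ord.
  apply: ler_sum => i _.
  apply: (@le_trans _ _ (\sum_(j < n) d)); last by rewrite sumr_const card_ord.
  apply: ler_sum => j _; rewrite !mxE normc_subC.
  have [_ /(_ i j)] := AB; rewrite /ball /= ltcR => /ltW; exact.
rewrite /d mulrCA gtr_pMr// ltr_pdivrMr// mul1r ltr_nat ltnS//.
Unshelve. all: by end_near.
Qed.

End blocks.

(** * The formal coboundary of f is a nontrivial cocycle *)

Section special.
Variable R : realType.
Variables (chi : 'M[R[i]]_2 -> R[i]).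
Hypothesis chiP : unitary_character chi.
Local Notation f := (@f_exp R).
Local Notation nu := (@nuS R).

Lemma opT_f_cvg (g0 : 'M[R[i]]_(2 + 2)) : grpP g0 ->
  L2norm nu (fun s => opT chi g f s - opT chi g0 f s)
    @[g --> within (@grpP R) (nbhs g0)] --> 0%E.
Proof.
move=> Gg0; have [n0 [t0 [n0N g0E]]] := (P_decomposition g0).1 Gg0.
have [K K0 hK] := energy_opT_f_dist chiP.
pose c := (2 * S_norm (Defs.invS t0))^-1.
have c0 : 0 < c by rewrite invr_gt0 mulr_gt0// S_norm_gt0.
pose I := (\int[nu]_s (S_norm s ^+ 2 * expR (- (c * S_norm s)))%:E)%E.
have I0 : (0 <= I)%E.
  apply: integral_ge0 => s _.
  by rewrite lee_fin mulr_ge0 ?expR_ge0// exprn_ge0// ltW// S_norm_gt0.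
have IE : I = (fine I)%:E.
  by rewrite fineK// ge0_fin_numE//; exact: integral_nu_norm2exp.
(* This is the last factor in [NS_dist] with its e replaced by the bound 1, so |n - n0| <= M |g -
   g0| near g0. *)
pose M := mnorm t0 + 1 + mnorm (dlsubmx g0).
have M0 : 0 <= M by rewrite !addr_ge0 ?mnorm_ge0.
pose Q := (K * M + 1) * fine I.
have Q0 : 0 <= Q by rewrite mulr_ge0 ?fine_ge0// addr_ge0// mulr_ge0.
have e_cvg : mnorm (g - g0) @[g --> within (@grpP R) (nbhs g0)] --> (0 : R).
  by apply: cvg_within_filter; exact: mnorm_sub_cvg0.
apply: (@squeeze_cvge _ _ _ _ (fun=> 0%E) _
  (fun g => (Num.sqrt (mnorm (g - g0) * Q))%:E)); last 2 first.
- exact: cvg_cst.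
- apply: cvg_EFin; first exact: nearW.
  have -> : (0 : R) = Num.sqrt (0 * Q) by rewrite mul0r sqrtr0.
  apply: (@cvg_comp _ _ _ _ (@Num.sqrt R)); last exact: sqrt_continuous.
  by apply: cvgM => //; exact: cvg_cst.
near=> g.
(* The bound 1 serves for [M] and for e^2 <= e; the bound c is the distance allowed by
   [S_norm_mul_ge_near]. *)
have e1 : mnorm (g - g0) < Num.min 1 c.
  near: g; move/cvgrPdist_lt : e_cvg => /(_ (Num.min 1 c)).
  rewrite lt_min ltr01 c0 => /(_ isT); apply: filterS => g.
  by rewrite sub0r normrN ger0_norm ?mnorm_ge0.
have Gg : grpP g by near: g; exact: withinT.
have [n [t [nN gE]]] := (P_decomposition g).1 Gg.
rewrite L2normE poweR_ge0 /= -L2normE.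
move: e1; set e := mnorm (g - g0); rewrite lt_min => /andP[/ltW e1 /ltW ec].
have e0 : 0 <= e by exact: mnorm_ge0.
apply: L2norm_le_fin; first by rewrite mulr_ge0.
have [hD hn] : norm4 (sub4 (S_coord t) (S_coord t0)) <= e /\
    mnorm (n - n0) <= e * (mnorm t0 + e + mnorm (dlsubmx g0)).
  by rewrite g0E; apply: NS_dist; rewrite -g0E -gE.
have ct : forall s, c * S_norm s <= S_norm (mulS s t).
  by apply: S_norm_mul_ge_near; exact: le_trans hD ec.
have ct0 : forall s, c * S_norm s <= S_norm (mulS s t0).
  apply: S_norm_mul_ge_near; rewrite (_ : norm4 _ = 0) ?(ltW c0)//.
  by rewrite /norm4 /sq4 /sub4 /= !subrr !expr0n/= !addr0 sqrtr0.
rewrite gE g0E; apply: (le_trans (hK _ _ _ _ _ nN n0N ct ct0)).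
rewrite -/I IE -EFinM lee_fin /Q mulrA ler_wpM2r ?fine_ge0// mulrDr mulr1.
apply: lerD; last first.
  apply: (@le_trans _ _ (e ^+ 2)); first
    by rewrite ler_pXn2r ?nnegrE ?norm4_ge0.
  by rewrite expr2 ler_piMr.
rewrite mulrCA ler_wpM2l//; apply: (le_trans hn); rewrite ler_wpM2l//.
by rewrite /M lerD2r lerD2l.
Unshelve. all: by end_near.
Qed.

Lemma opT_f_cocycle : cocycle nu (@grpP R) (opT chi)
  (fun g s => opT chi g f s - f s).
Proof.
split.
- by move=> g Gg; exact: opT_f_sub_L2.
- move=> g0 Gg0.
  under eq_fun => g.
    rewrite (_ : (fun x => _) = (fun s => opT chi g f s - opT chi g0 f s));
      last first.
      by apply/funext => s; rewrite opprB addrA subrK.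
    over.
  exact: opT_f_cvg.
- move=> g1 g2 G1 G2; apply: aeW => s.
  rewrite opTM//.
  have -> : opT chi g1 (fun s => opT chi g2 f s - f s) s =
      opT chi g1 (opT chi g2 f) s - opT chi g1 f s by rewrite /opT mulrBr.
  by rewrite addrA subrK.
Qed.

Lemma normc_f_sq s : normc (f s) ^+ 2 = expR (- S_norm s).
Proof.
by rewrite f_expE normc_real ger0_norm ?expR_ge0// expr2 -expRD; congr expR;
  field.
Qed.

Lemma energy_f_infinite : ~ (energy nu f < +oo)%E.
Proof.
pose G (l : R) (s : lowS R) := (expR (- (l * S_norm s)))%:E.
have mG l : measurable_fun setT (G l).
  apply/measurable_EFinP; apply: (measurableT_comp (@measurable_expR R)).
  apply: (measurableT_comp (@oppr_measurable R setT)).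
  by apply: measurable_funM; [exact: measurable_cst|exact: measurable_S_norm].
have G0 l s : (0 <= G l s)%E by rewrite lee_fin expR_ge0.
have -> : energy nu f = (\int[nu]_s G 1%R s)%E.
  by apply: eq_integral => s _; rewrite normc_f_sq /G mul1r.
move=> Goo.
have G2 : (\int[nu]_s G 2%R s = \int[nu]_s G 1%R s)%E.
  rewrite -[RHS](ge0_integral_nu_dil (ltr0Sn R 1) (mG 1) (G0 1)).
  by apply: eq_integral => s _; rewrite /G S_norm_dil// mul1r.
pose H (s : lowS R) := (expR (- S_norm s) - expR (- (2 * S_norm s)))%:E.
have Hgt (s : lowS R) : 0 < expR (- S_norm s) - expR (- (2 * S_norm s)).
  by rewrite subr_gt0 ltr_expR ltrN2 ltr_pMl ?S_norm_gt0// ltr1n.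
have mH : measurable_fun setT H.
  apply/measurable_EFinP; apply: measurable_funB; apply/measurable_EFinP;
    last exact: (mG 2).
  by have := mG 1; rewrite /G; under eq_fun do rewrite mul1r.
have HG : (\int[nu]_s G 1%R s = \int[nu]_s H s + \int[nu]_s G 1%R s)%E.
  rewrite -{2}G2 -ge0_integralD//; last first.
    by move=> s _; rewrite lee_fin ltW.
  by apply: eq_integral => s _; rewrite /G /H -EFinD mul1r subrK.
(* The integral of [G 1] is finite by assumption, so it can be cancelled in [HG]. *)
have H0 : (\int[nu]_s `|H s| = 0)%E.
  under eq_integral do rewrite abse_EFin ger0_norm ?(ltW (Hgt _))//.
  have h0 : (0 <= \int[nu]_s H s)%E
    by apply: integral_ge0 => s _; rewrite lee_fin ltW.
  have g0 : (0 <= \int[nu]_s G 1%R s)%E by exact: integral_ge0.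
  move: HG h0 g0 Goo; rewrite /H.
  case: (integral _ _ (G 1%R)) => [A| |];
    case: (integral _ _ _) => [B| |] //= [].
  move=> AB _ _ _; congr EFin; lra.
(* Thus [H] vanishes almost everywhere although it is positive everywhere, which would make S itself
   a null set. *)
move/(ae_eq_integral_abs nu measurableT mH) : H0 => [N [mN N0 sN]].
have : nu setT = 0%E.
  apply: (subset_measure0 _ _ _ N0) => // s _; apply: sN => /= /(_ I) /eqP.
  by rewrite /H eqe gt_eqF.
by move/eqP; rewrite (negbTE (nuS_setT_neq0 R)).
Qed.

Lemma opT_f_not_coboundary : ~ coboundary nu (@grpP R) (opT chi)
  (fun g s => opT chi g f s - f s).
Proof.
move=> [xi /L2P[mxi exi] h]; apply: energy_f_infinite.
(* This is |f(s) - f(l s)|^2 for the dilation factor l = n + 1, which is positive for every n. *)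
pose w n (s : lowS R) : R :=
  (expR (- (S_norm s / 2)) - expR (- (S_norm s / 2 * n.+1%:R))) ^+ 2.
have mexp (l : R) :
    measurable_fun setT (fun s : lowS R => expR (- (S_norm s * l))).
  apply: (measurableT_comp (@measurable_expR R)).
  apply: (measurableT_comp (@oppr_measurable R setT)).
  by apply: measurable_funM; [exact: measurable_S_norm|exact: measurable_cst].
have mw n : measurable_fun setT (w n).
  apply: measurable_funX; apply: measurable_funB => //.
  rewrite (_ : (fun _ => _) =
      fun s : lowS R => expR (- (S_norm s * (2^-1 * n.+1%:R))));
        first exact: mexp.
  by apply/funext => s; rewrite mulrA.
have w_bound n : (\int[nu]_s (w n s)%:E <= 4%:E * energy nu xi)%E.
  pose t := dilS n.+1%:R : lowS R.
  have n0 : 0 < n.+1%:R :> R by [].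
  have Gt : grpP (S_block t) by exact: P_S.
  have tE : S_block t = N_block 0 *m S_block t by rewrite N_block0 mul1mx.
  have tT F : opT chi (S_block t) F = fun s => F (mulS s t).
    rewrite tE opT_NS; apply/funext => s.
    by rewrite mulmx0 mul0mx (char0 chiP) mul1r.
  pose v (s : lowS R) :=
    (2 * normc (xi (mulS s t)) ^+ 2 + 2 * normc (xi s) ^+ 2)%:E.
  have mxi2 := measurable_normc2 mxi.
  have mxit2 := measurable_normc2
    (measurable_complex_comp mxi (measurable_mulS t)).
  apply: (@le_trans _ _ (\int[nu]_s v s)%E).
    apply: ae_ge0_le_integral => //.
    - by move=> s _; rewrite lee_fin sqr_ge0.
    - by apply/measurable_EFinP.
    - by move=> s _; rewrite lee_fin; apply: addr_ge0; apply: mulr_ge0;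
      rewrite ?sqr_ge0.
    - apply/measurable_EFinP; apply: measurable_funD; apply: measurable_funM.
      + exact: measurable_cst.
      + exact: mxit2.
      + exact: measurable_cst.
      + exact: mxi2.
    (* The coboundary equation holds only almost everywhere for this fixed dilation, which is enough
       to compare integrals. Both terms of [v] then integrate to twice the energy of [xi], the first
       by dilation invariance: hence the 4. *)
    apply: filterS (h _ Gt) => s; rewrite !tT => hs _.
    rewrite lee_fin; have := normcD_sq (xi (mulS s t)) (- xi s).
    rewrite -(hs Logic.I) normc_opp.
    apply: le_trans; rewrite !f_expE -rmorphB normc_real real_normK ?num_real//.
    rewrite /w S_norm_dil// -[leRHS]sqrrN opprB.
    by rewrite (_ : n.+1%:R * S_norm s / 2 = S_norm s / 2 * n.+1%:R)//; ring.
  rewrite /v; under eq_integral do rewrite EFinD !EFinM.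
  have eE : (\int[nu]_s (2%:E * (normc (xi s) ^+ 2)%:E) =
    2%:E * energy nu xi)%E.
    rewrite ge0_integralZl//; first exact/measurable_EFinP.
    by move=> s _; rewrite lee_fin sqr_ge0.
  rewrite ge0_integralD//.
  - rewrite eE (ge0_integral_nu_dil (l := n.+1%:R)
      (F := fun s => 2%:E * (normc (xi s) ^+ 2)%:E)%E)//.
    + rewrite eE -ge0_muleDl ?lee_fin//.
      by rewrite -EFinD (_ : 2 + 2 = 4 :> R)//; ring.
    + by apply: measurable_funeM; exact/measurable_EFinP.
    + by move=> s; rewrite mule_ge0// lee_fin sqr_ge0.
  - by move=> s _; rewrite mule_ge0// lee_fin sqr_ge0.
  - by apply: measurable_funeM; exact/measurable_EFinP.
  - by move=> s _; rewrite mule_ge0// lee_fin sqr_ge0.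
  - by apply: measurable_funeM; exact/measurable_EFinP.
have w_cvg (s : lowS R) : (w n s)%:E @[n --> \oo] --> (normc (f s) ^+ 2)%:E.
  apply: cvg_EFin; first exact: nearW.
  rewrite normc_f_sq.
  set a := expR (- (S_norm s / 2)).
  have -> : expR (- S_norm s) = (a - 0) * (a - 0).
    by rewrite subr0 /a -expRD; congr expR; field.
  have -> : fine \o (fun n => (w n s)%:E) =
    fun n => (a - a ^+ n.+1) * (a - a ^+ n.+1).
    have eX (x : R) n : expR (- (x * n%:R)) = expR (- x) ^+ n.
      by rewrite -mulNr expRM_natr.
    by apply/funext => n; rewrite /= /w eX expr2.
  have ca : (a ^+ n.+1) @[n --> \oo] --> (0 : R).
    rewrite (cvg_shiftS (fun n => a ^+ n)); apply: cvg_expr.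
    by rewrite ger0_norm ?expR_ge0// -expR0 ltr_expR oppr_lt0 divr_gt0//
      S_norm_gt0.
  have cb : (a - a ^+ n.+1) @[n --> \oo] --> a - 0
    by apply: cvgB => //; exact: cvg_cst.
  exact: cvgM.
(* Since f(l s) decreases in l and stays below f(s) for l >= 1, the squares increase, and monotone
   convergence carries the uniform bound to |f|^2. *)
have w_nd (s : lowS R) : {homo (fun n => (w n s)%:E) :
    m n / (m <= n)%N >-> (m <= n)%E}.
  move=> m n mn; rewrite lee_fin /w.
  have q0 : 0 < S_norm s / 2 by rewrite divr_gt0// S_norm_gt0.
  have em k : expR (- (S_norm s / 2 * k.+1%:R)) <= expR (- (S_norm s / 2)).
    by rewrite ler_expR lerN2 ler_peMr ?(ltW q0)// ler1n.
  rewrite ler_pXn2r ?nnegrE ?subr_ge0//.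
  by rewrite lerD2l lerN2 ler_expR lerN2 ler_pM2l// ler_nat ltnS.
apply: (@le_lt_trans _ _ (4%:E * energy nu xi)%E); last first.
  by rewrite lte_mul_pinfty ?lee_fin ?energy_ge0.
rewrite /energy.
rewrite (_ : (\int[nu]_x (normc (f x) ^+ 2)%:E)%E =
  limn (fun n => \int[nu]_s (w n s)%:E)%E).
  apply: lime_le; last exact: nearW.
  apply: ereal_nondecreasing_is_cvgn => m n mn; apply: ge0_le_integral => //.
  - by move=> s _; rewrite lee_fin sqr_ge0.
  - exact/measurable_EFinP.
  - exact/measurable_EFinP.
  - by move=> s _; exact: w_nd.
rewrite -monotone_convergence//.
- by apply: eq_integral => s _; exact/esym/cvg_lim.
- by move=> n; exact/measurable_EFinP.
- by move=> n s _; rewrite lee_fin sqr_ge0.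
Qed.

End special.

Theorem theorem3 (R : realType) (chi : 'M[R[i]]_2 -> R[i])
    (chi_character : unitary_character chi)
    (chi_nondegenerate : in_nondegenerate_orbit chi) :
  [/\ L2_representation (@nuS R) (@grpP R) (opT chi),
      special (@nuS R) (@grpP R) (opT chi)
    & nontrivial_cocycle (@nuS R) (@grpP R) (opT chi)
        (fun g s => opT chi g (@f_exp R) s - @f_exp R s)].
Proof.
have b_nontrivial : nontrivial_cocycle (@nuS R) (@grpP R) (opT chi)
    (fun g s => opT chi g (@f_exp R) s - @f_exp R s).
  by split; [exact: opT_f_cocycle|exact: opT_f_not_coboundary].
split=> //; first exact: opT_representation.
by eexists; exact: b_nontrivial.
Qed.
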